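(* For $1\le j\le3$ and all $x\in\mathbb R^3\setminus\{0\}$, $Z_{j1}(x,0)=E_{j1}(x)$.
   Context: Fixed parameters: $\tau\in(0,\infty)$, $\varrho\in\mathbb R\setminus\{0\}$; $e_1=(1,0,0)$. $\Omega:=\varrho\begin{pmatrix}0&0&0\\0&0&-1\\0&1&0\end{pmatrix}$. Let $\psi(r):=\int_0^r(1-e^{-t})\,t^{-1}\,dt$ for $r\in\mathbb R$, $\Phi(x):=(4\pi\tau)^{-1}\psi(\tau(|x|-x_1)/2)$ for $x\in\mathbb R^3$, and $E_{jk}(x):=(\delta_{jk}\Delta-\partial_j\partial_k)\Phi(x)$ for $x\in\mathbb R^3\setminus\{0\}$, $1\le j,k\le3$ (velocity part of the fundamental solution of the Oseen system $-\Delta v+\tau\partial_1v+\nabla q=f$, $\mathrm{div}\,v=0$). Let $N(x):=(4\pi|x|)^{-1}$ for $x\ne0$, $K(x,t):=(4\pi t)^{-3/2}e^{-|x|^2/(4t)}$ for $x\in\mathbb R^3$, $t>0$, and $T_{jk}(x,t):=\delta_{jk}K(x,t)+\partial_j\partial_k\bigl(\int_{\mathbb R^3}N(x-y)K(y,t)\,dy\bigr)$ (derivatives with respect to $x$), $1\le j,k\le3$. With $T=(T_{jk})$, define the $3\times3$ matrix $\Gamma(x,y,t):=T(x-\tau te_1-e^{-t\Omega}y,\,t)\cdot e^{-t\Omega}$ for $x,y\in\mathbb R^3$, $t>0$, and $Z_{jk}(x,y):=\int_0^\infty\Gamma_{jk}(x,y,t)\,dt$ for $x\ne y$, $1\le j,k\le3$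 (the integral converges absolutely). *)

(* Defs.v *)
From HB Require Import structures.
From mathcomp Require Import all_boot all_order all_algebra.
From mathcomp Require Import all_classical all_reals all_analysis.

Set Implicit Arguments.
Unset Strict Implicit.
Unset Printing Implicit Defensive.

Import Order.TTheory GRing.Theory Num.Theory.
Import numFieldNormedType.Exports.

Local Open Scope classical_set_scope.
Local Open Scope ring_scope.

(* Points of R^3 are column vectors, so that 3 x 3 matrices act on them by *m.
   Indices are shifted by one: coordinate 1 is (0 : 'I_3), and so on. *)

Section Oseen.
Variable R : realType.

Local Notation mu := (@lebesgue_measure R).

Definition vec3 (a b c : R) : 'cV[R]_3 := \col_(i < 3) nth 0 [:: a; b; c] i.

Definition e1 : 'cV[R]_3 := vec3 1 0 0.

(* The library norm `|x| on matrices is the sup norm. *)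
Definition enorm (x : 'cV[R]_3) : R := Num.sqrt (\sum_(i < 3) x i 0 ^+ 2).

Definition partial (j : 'I_3) (f : 'cV[R]_3 -> R) (x : 'cV[R]_3) : R :=
  'D_(delta_mx j 0 : 'cV[R]_3) f x.

Definition laplacian (f : 'cV[R]_3 -> R) (x : 'cV[R]_3) : R :=
  \sum_(i < 3) partial i (partial i f) x.

Definition integral_R3 (f : 'cV[R]_3 -> R) : R :=
  \int[((mu \x mu) \x mu)%E]_p f (vec3 p.1.1 p.1.2 p.2).

Definition expmx (A : 'M[R]_3) : 'M[R]_3 :=
  limn (series (fun n => (n`!%:R)^-1 *: A ^+ n)).

Definition Omega (rho : R) : 'M[R]_3 :=
  rho *: \matrix_(i < 3, j < 3)
    nth 0 (nth [::] [:: [:: 0; 0; 0];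
                        [:: 0; 0; -1];
                        [:: 0; 1; 0]] i) j.

(* For r < 0 the integral from 0 to r is minus the integral over [r, 0]. *)
Definition psi (r : R) : R :=
  if 0 <= r then \int[mu]_(t in `[0, r]) ((1 - expR (- t)) * t^-1)
  else - \int[mu]_(t in `[r, 0]) ((1 - expR (- t)) * t^-1).

Definition Phi (tau : R) (x : 'cV[R]_3) : R :=
  (4 * pi * tau)^-1 * psi (tau * (enorm x - x 0 0) / 2).

Definition E (tau : R) (j k : 'I_3) (x : 'cV[R]_3) : R :=
  (j == k)%:R * laplacian (Phi tau) x - partial j (partial k (Phi tau)) x.

Definition newton (x : 'cV[R]_3) : R := (4 * pi * enorm x)^-1.

Definition heat (x : 'cV[R]_3) (t : R) : R :=
  (4 * pi * t) `^ (- (3 / 2)) * expR (- (enorm x ^+ 2 / (4 * t))).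

Definition T (x : 'cV[R]_3) (t : R) : 'M[R]_3 :=
  \matrix_(j < 3, k < 3)
    ((j == k)%:R * heat x t +
     partial j (partial k
       (fun z => integral_R3 (fun y => newton (z - y) * heat y t))) x).

Definition Gamma (tau rho : R) (x y : 'cV[R]_3) (t : R) : 'M[R]_3 :=
  T (x - (tau * t) *: e1 - expmx (- t *: Omega rho) *m y) t
    *m expmx (- t *: Omega rho).

(* Extended-real valued, so that equality with a real number also excludes a
   divergent integral (Rintegral would silently turn it into 0). *)
Definition Z (tau rho : R) (j k : 'I_3) (x y : 'cV[R]_3) : \bar R :=
  (\int[mu]_(t in `]0%R, +oo[) (Gamma tau rho x y t j k)%:E)%E.

End Oseen.

(* Main.v *)
Require Import Defs.
From HB Require Import structures.
From mathcomp Require Import all_boot all_order all_algebra.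
From mathcomp Require Import all_classical all_reals all_analysis.
From mathcomp Require Import measurable_realfun ring lra.
Set Implicit Arguments.
Unset Strict Implicit.
Unset Printing Implicit Defensive.
Import Order.TTheory GRing.Theory Num.Theory.
Import numFieldNormedType.Exports.
Local Open Scope classical_set_scope.
Local Open Scope ring_scope.

(** For y = 0 the rotation no longer enters the argument of T, and it fixes e_1,
    so Z_{j1}(x, 0) is the integral over t > 0 of T_{j1}(x - tau t e_1, t).
    Let M_n(y) be the integral of w^n exp(-y w^2) over w in [0, 1], so that
    M_n' = - M_{n+2} and 2 y M_{n+2}(y) = (n+1) M_n(y) - exp(-y).  Writing N as a
    superposition of Gaussians gives U_t := N * K_t as an explicit multiple of
    M_0(|x|^2 / (4t)), hence T in terms of M_2 and M_4.  Since U_t solves the heat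
    equation with Laplacian -K_t,
      tau d_j d_1 U_t = - d/dt [d_j U_t] - d_j K_t   at x - tau t e_1,
    and what remains, K_t and K_t / t along this line, is exp(- a^2/t - b^2 t) times
    a power of t and has a primitive built from the error function; the integral
    is therefore a difference of limits.
    On the other side psi' = 2 M_1, which yields E_{j1} in closed form, including on
    the half-line where |x| = x_1. *)

(** * Differentiation rules and integration over the half-line *)

(** If x = |x| e_1, the path x - tau t e_1 meets the origin at t = |x| / tau, and s = tau (|x| -
    x_1) / 2 vanishes; closed forms in the error function or in (1 - exp(-s)) / s have removable
    singularities there. The moments are smooth at 0 and relations such as 2 s M_1(s) = 1 - exp(-s)
    hold there too, so no case distinction on x is needed. The second obstacle is that [Z] is a
    Lebesgue integral of a function without fixed sign, so the limits of a primitive do not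
    determine it by themselves. Absolute integrability comes from an explicit majorant, shaped so
    that it has an elementary primitive of its own. *)

Section DeriveRules.
Context {R : realType}.
Implicit Types (f g : R -> R) (x a b : R).

Lemma is_derive1_funD f g x a b : is_derive x 1 f a -> is_derive x 1 g b ->
  is_derive x 1 (fun t => f t + g t) (a + b).
Proof. exact: is_deriveD. Qed.

Lemma is_derive1_funB f g x a b : is_derive x 1 f a -> is_derive x 1 g b ->
  is_derive x 1 (fun t => f t - g t) (a - b).
Proof. exact: is_deriveB. Qed.

Lemma is_derive1_funN f x a : is_derive x 1 f a -> is_derive x 1 (fun t => - f t) (- a).
Proof. exact: is_deriveN. Qed.

Lemma is_derive1_funM f g x a b : is_derive x 1 f a -> is_derive x 1 g b ->
  is_derive x 1 (fun t => f t * g t) (a * g x + f x * b).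
Proof.
move=> fa gb; have := is_deriveM fa gb; move/is_derive_eq; apply.
by rewrite addrC /GRing.scale/= (mulrC a).
Qed.

Lemma is_derive1_funX f n x a : is_derive x 1 f a ->
  is_derive x 1 (fun t => f t ^+ n) (n%:R * f x ^+ n.-1 * a).
Proof. by move=> fa; have := is_deriveX n fa; rewrite exprfctE. Qed.

Lemma is_derive1_funV f x a : is_derive x 1 f a -> f x != 0 ->
  is_derive x 1 (fun t => (f t)^-1) (- a / f x ^+ 2).
Proof.
move=> fa f0; have := is_deriveV f0 fa; move/is_derive_eq; apply.
by rewrite /GRing.scale/= mulNr mulrC mulNr.
Qed.

Lemma is_derive1_funchain f g x a b : is_derive (g x) 1 f a -> is_derive x 1 g b ->
  is_derive x 1 (fun t => f (g t)) (a * b).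
Proof. exact: is_derive1_comp. Qed.

Lemma is_derive1_funexpR f x a : is_derive x 1 f a ->
  is_derive x 1 (fun t => expR (f t)) (expR (f x) * a).
Proof. by move=> fa; apply: (is_derive1_funchain (f := expR)); exact: is_derive_expR. Qed.

Lemma is_derive1_funsqrt f x a : is_derive x 1 f a -> 0 < f x ->
  is_derive x 1 (fun t => Num.sqrt (f t)) (a / (2 * Num.sqrt (f x))).
Proof.
move=> fa f0; have := is_derive1_funchain (is_derive1_sqrt f0) fa; move/is_derive_eq; apply.
by rewrite mulrC.
Qed.

Lemma is_derive1_funcst x (k : R) : is_derive x 1 (fun=> k) 0.
Proof. exact: is_derive_cst. Qed.

Lemma is_derive1_funid x : is_derive x 1 (fun t : R => t) 1.
Proof. exact: is_derive_id. Qed.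

Lemma is_derive_continuous f x a : is_derive x 1 f a -> {for x, continuous f}.
Proof. by move=> fa; exact/differentiable_continuous/derivable1_diffP. Qed.

Lemma is_derive_derive1 f x a : is_derive x 1 f a -> (derive1 f) x = a.
Proof. by move=> fa; rewrite derive1E derive_val. Qed.

End DeriveRules.

(* Plain [apply:] would let class resolution pick the library instances, whose
   derivatives are expressed with [*:] over [R^o]. *)
Ltac derive_rules :=
  repeat first
    [ eassumption
    | notypeclasses refine (@is_derive1_funid _ _)
    | notypeclasses refine (@is_derive1_funcst _ _ _)
    | notypeclasses refine (@is_derive1_funD _ _ _ _ _ _ _ _)
    | notypeclasses refine (@is_derive1_funB _ _ _ _ _ _ _ _)
    | notypeclasses refine (@is_derive1_funN _ _ _ _ _)
    | notypeclasses refine (@is_derive1_funM _ _ _ _ _ _ _ _)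
    | notypeclasses refine (@is_derive1_funX _ _ _ _ _ _)
    | notypeclasses refine (@is_derive1_funexpR _ _ _ _ _)
    | notypeclasses refine (@is_derive1_funsqrt _ _ _ _ _ _)
    | notypeclasses refine (@is_derive1_funV _ _ _ _ _ _) ].

Lemma is_derive_val {R : realType} (f : R -> R) (x a b : R) :
  is_derive x 1 f a -> a = b -> is_derive x 1 f b.
Proof. by move=> ? <-. Qed.

Ltac derive_by := notypeclasses refine (@is_derive_val _ _ _ _ _ _ _); [derive_rules|].

Section ImproperFTC.
Context {R : realType}.
Notation mu := (@lebesgue_measure R).

Lemma FTC2_cc (f F : R -> R) (a b : R) : a < b ->
  (forall x : R, is_derive x 1 F (f x)) -> continuous f ->
  \int[mu]_(x in `[a, b]) f x = F b - F a.
Proof.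
move=> ab dF cf.
have cF : continuous F by move=> x; exact: is_derive_continuous (dF x).
rewrite /Rintegral (continuous_FTC2 ab (F := F))//.
- exact: continuous_subspaceT.
- split.
  + by move=> x _; have := dF x => -[].
  + exact/cvg_at_right_filter/cF.
  + exact/cvg_at_left_filter/cF.
- by move=> x _; exact: is_derive_derive1.
Qed.

(** Nothing is known at 0 beyond the limit of F, so the integral is cut off at 1/(n+1), evaluated on
    the closed half-line, and recovered by monotone convergence. *)
Lemma ge0_FTC0y (f F : R -> R) (A B : R) :
  (forall x : R, 0 < x -> 0 <= f x) ->
  (forall x : R, 0 < x -> is_derive x 1 F (f x)) ->
  (forall x : R, 0 < x -> {for x, continuous f}) ->
  F x @[x --> 0^'+] --> A -> F x @[x --> +oo] --> B ->
  (\int[mu]_(x in `]0%R, +oo[) (f x)%:E = (B - A)%:E)%E.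
Proof.
move=> f0 dF cf FA FB.
have mf : measurable_fun (`]0, +oo[%classic : set R) (fun x => (f x)%:E).
  apply/measurable_EFinP; apply: open_continuous_measurable_fun.
    exact: interval_open.
  by move=> x; rewrite inE/= in_itv/= andbT => /cf.
pose e n : R := n.+1%:R^-1.
have e0 n : 0 < e n by rewrite invr_gt0.
pose g n x := ((f \_ `[e n, +oo[) x)%:E.
have gE n : (\int[mu]_(x in `]0%R, +oo[) g n x = (B - F (e n))%:E)%E.
  transitivity (\int[mu]_(x in `[e n, +oo[) (f x)%:E)%E.
    rewrite (_ : g n = (EFin \o f) \_ `[e n, +oo[); last by rewrite restrict_EFin.
    rewrite -integral_mkcondr; congr (integral _ _ _); apply/seteqP; split=> x/=.
      by case.
    by rewrite !in_itv/= !andbT => nx; split => //; exact: lt_le_trans nx.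
  apply: ge0_continuous_FTC2y => //.
  - by move=> x nx; apply: f0; exact: lt_le_trans nx.
  - apply/continuous_in_subspaceT => x; rewrite inE/= in_itv/= andbT => nx.
    by apply: cf; exact: lt_le_trans nx.
  - by move=> x nx; have [] := dF x (lt_trans (e0 n) nx).
  - by apply: cvg_at_right_filter; exact: is_derive_continuous (dF _ (e0 n)).
  - move=> x; rewrite in_itv/= andbT => nx.
    by apply: is_derive_derive1; apply: dF; exact: lt_trans nx.
have mono : (\int[mu]_(x in `]0%R, +oo[) g n x)%E @[n --> \oo] -->
    (\int[mu]_(x in `]0%R, +oo[) (f x)%:E)%E.
  rewrite (_ : (\int[mu]_(x in `]0%R, +oo[) (f x)%:E)%E =
     (\int[mu]_(x in `]0%R, +oo[) limn (g ^~ x))%E).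
    apply: cvg_monotone_convergence => //=.
    - move=> n; rewrite /g; apply/measurable_EFinP.
      apply/(measurable_restrict _ _ _).1 => //.
      by apply: (measurable_funS _ (@subIsetl _ _ _)) => //; exact/measurable_EFinP.
    - move=> n x; rewrite in_itv/= andbT => x0; rewrite /g lee_fin patchE.
      by case: ifP => // _; exact: f0.
    - move=> x; rewrite in_itv/= andbT => x0 n m nm; rewrite /g lee_fin !patchE.
      case: ifPn => [|_]; last by case: ifP => // _; exact: f0.
      rewrite inE/= in_itv/= andbT => nx; rewrite ifT// inE/= in_itv/= andbT.
      by apply: le_trans nx; rewrite lef_pV2 ?posrE// ler_nat ltnS.
  apply: eq_integral => x; rewrite inE/= in_itv/= andbT => x0.
  apply/esym/cvg_lim => //; apply: cvg_near_cst.
  apply: filterS (near_infty_natSinv_lt (PosNum x0)) => n /= /ltW nx.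
  by rewrite /g patchE ifT// inE/= in_itv/= andbT.
move: mono; under eq_fun do rewrite gE.
move=> mono; apply: (cvg_unique _ mono) => //.
apply: cvg_EFin; first exact: nearW.
apply: cvgB; first exact: cvg_cst.
have := (cvg_at_rightP F 0 A).1 FA; apply; split => //.
exact: cvg_harmonic.
Qed.

(** Both f + g and g are nonnegative, so the previous lemma gives them finite integrals; they are
    therefore integrable and may be subtracted. *)
Lemma dominated_FTC0y (f g F G : R -> R) (A B C D : R) :
  (forall x : R, 0 < x -> `|f x| <= g x) ->
  (forall x : R, 0 < x -> is_derive x 1 F (f x)) ->
  (forall x : R, 0 < x -> is_derive x 1 G (g x)) ->
  (forall x : R, 0 < x -> {for x, continuous f}) ->
  (forall x : R, 0 < x -> {for x, continuous g}) ->
  F x @[x --> 0^'+] --> A -> F x @[x --> +oo] --> B ->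
  G x @[x --> 0^'+] --> C -> G x @[x --> +oo] --> D ->
  (\int[mu]_(x in `]0%R, +oo[) (f x)%:E = (B - A)%:E)%E.
Proof.
move=> fg dF dG cf cg FA FB GC GD.
have g0 x : 0 < x -> 0 <= g x by move=> /fg; exact: le_trans.
have intg := ge0_FTC0y g0 dG cg GC GD.
have intfg : (\int[mu]_(x in `]0%R, +oo[) (f x + g x)%:E = ((B + D) - (A + C))%:E)%E.
  apply: (@ge0_FTC0y _ (fun x => F x + G x)).
  - by move=> x /fg; rewrite ler_norml => /andP[+ _]; rewrite -subr_ge0 opprK.
  - by move=> x x0; apply: is_derive1_funD; [exact: dF|exact: dG].
  - by move=> x x0; apply: cvgD; [exact: cf|exact: cg].
  - exact: cvgD.
  - exact: cvgD.
have mcont (h : R -> R) : (forall x : R, 0 < x -> {for x, continuous h}) ->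
    measurable_fun (`]0, +oo[%classic : set R) (fun x => (h x)%:E).
  move=> ch; apply/measurable_EFinP; apply: open_continuous_measurable_fun.
    exact: interval_open.
  by move=> x; rewrite inE/= in_itv/= andbT => /ch.
have ige0 (h : R -> R) (r : R) : (forall x : R, 0 < x -> {for x, continuous h}) ->
    (forall x : R, 0 < x -> 0 <= h x) ->
    (\int[mu]_(x in `]0%R, +oo[) (h x)%:E = r%:E)%E ->
    mu.-integrable `]0%R, +oo[ (EFin \o h).
  move=> ch h0 hr; apply/integrableP; split; first exact: mcont.
  rewrite [ltLHS](_ : _ = r%:E) ?ltry// -hr; apply: eq_integral => x.
  by rewrite inE/= in_itv/= andbT => /h0 ?; rewrite ger0_norm.
have ig := ige0 _ _ cg g0 intg.
have ifg : mu.-integrable `]0%R, +oo[ (EFin \o (fun x => f x + g x)).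
  apply: (ige0 _ _ _ _ intfg).
  - by move=> x x0; apply: cvgD; [exact: cf|exact: cg].
  - by move=> x /fg; rewrite ler_norml => /andP[+ _]; rewrite -subr_ge0 opprK.
transitivity (\int[mu]_(x in `]0%R, +oo[) ((f x + g x)%:E - (g x)%:E))%E.
  by apply: eq_integral => x _; rewrite /= -EFinB addrK.
rewrite integralB//= intfg intg -EFinB; congr EFin; lra.
Qed.

End ImproperFTC.

(** * Gaussian moments over the unit interval *)

Section GaussMoments.
Context {R : realType}.
Notation mu := (@lebesgue_measure R).
Implicit Types (y w v : R).

(** For even n this is the Boys function of index n/2, an incomplete Gamma function made smooth at
    0; for n = 1 it extends (1 - exp(-y)) / (2y). *)
Definition moment n y : R :=
  \int[mu]_(w in `[0, 1]) (w ^+ n * expR (- (y * w ^+ 2))).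

Lemma is_derive_moment_integrand_w n y w :
  is_derive w 1 (fun w => w ^+ n.+1 * expR (- (y * w ^+ 2)))
    (n.+1%:R * (w ^+ n * expR (- (y * w ^+ 2)))
     - 2 * y * (w ^+ n.+2 * expR (- (y * w ^+ 2)))).
Proof.
derive_by.
by rewrite /= !exprS; ring.
Qed.

Lemma is_derive_moment_integrand_y n y w :
  is_derive y 1 (fun y => w ^+ n * expR (- (y * w ^+ 2)))
    (- (w ^+ n.+2 * expR (- (y * w ^+ 2)))).
Proof.
derive_by.
by rewrite /= !exprS; ring.
Qed.

Lemma continuous_moment_integrand n y :
  continuous (fun w => w ^+ n * expR (- (y * w ^+ 2))).
Proof.
move=> w.
have [d h] : exists d, is_derive w 1 (fun w => w ^+ n * expR (- (y * w ^+ 2))) d.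
  by eexists; derive_rules.
exact: is_derive_continuous h.
Qed.

Lemma integrable_moment n y :
  mu.-integrable `[0%R, 1%R] (fun w => (w ^+ n * expR (- (y * w ^+ 2)))%:E).
Proof.
apply: continuous_compact_integrable; first exact: segment_compact.
exact/continuous_subspaceT/continuous_moment_integrand.
Qed.

Lemma is_derive_moment n y : is_derive y 1 (moment n) (- moment n.+2 y).
Proof.
pose f y w := w ^+ n * expR (- (y * w ^+ 2)).
have Dy : y \in `](y - 1), (y + 1)[ by rewrite in_itv/=; apply/andP; split; lra.
have d1E x w : partial1of2 f x w = - (w ^+ n.+2 * expR (- (x * w ^+ 2))).
  by rewrite /partial1of2; exact: is_derive_derive1 (is_derive_moment_integrand_y n x w).
(* For x within 1 of y and w in [0, 1], the exponent - x w^2 is at most |y| + 1, so a constant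
   dominates the derivative. *)
have Gub x w : `](y - 1), (y + 1)[%classic x -> `[0, 1]%classic w ->
    `|partial1of2 f x w| <= expR (`|y| + 1).
  rewrite /= !in_itv/= => /andP[x1 x2] /andP[w0 w1].
  rewrite d1E normrN normrM ger0_norm ?exprn_ge0// (ger0_norm (expR_ge0 _)).
  rewrite -[leRHS]mul1r ler_pM ?exprn_ge0 ?expR_ge0 ?exprn_ile1// ler_expR.
  have : - y <= `|y| by rewrite -normrN ler_norm.
  move=> yl; have yl' := ler_norm y.
  have xb : - x <= `|y| + 1 by lra.
  have w2 : 0 <= w ^+ 2 <= 1 by rewrite exprn_ge0//= exprn_ile1.
  have y0 := normr_ge0 y.
  by case/andP: w2 => w20 w21; nra.
have der x w : `](y - 1), (y + 1)[%classic x -> `[0, 1]%classic w ->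
    derivable (f ^~ w) x 1.
  by move=> _ _; have [] := is_derive_moment_integrand_y n x w.
have intf x : `](y - 1), (y + 1)[%classic x ->
    mu.-integrable `[0, 1] (EFin \o f x).
  by move=> _; exact: integrable_moment.
have intG : mu.-integrable `[0, 1] (EFin \o cst (expR (`|y| + 1))).
  apply: continuous_compact_integrable; first exact: segment_compact.
  by apply: continuous_subspaceT => ?; exact: cvg_cst.
have mI : measurable (`[0, 1]%classic : set R) by [].
have G0 (w : R) : 0 <= cst (expR (`|y| + 1)) w by exact: expR_ge0.
apply: DeriveDef.
  exact: (@derivable_under_integral _ _ _ mu f _ mI _ _ _ Dy intf der _ G0 intG Gub).
rewrite -derive1E (@differentiation_under_integral _ _ _ mu f _ mI _ _ _ Dy intf der _ G0 intG Gub).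
under eq_Rintegral do rewrite d1E -mulN1r.
by rewrite RintegralZl ?mulN1r//; exact: integrable_moment.
Qed.

(** Integrate the w-derivative of w^(n+1) exp(-y w^2) over [0, 1]; the boundary term at 0
    vanishes. *)
Lemma moment_rec n y :
  2 * y * moment n.+2 y = n.+1%:R * moment n y - expR (- y).
Proof.
have h := FTC2_cc ltr01 (is_derive_moment_integrand_w n y).
move: h; rewrite !expr1n expr0n/= mul0r subr0 mul1r mulr1 => <-; last first.
  move=> w; apply: cvgB; apply: cvgM; try exact: cvg_cst;
    exact: continuous_moment_integrand.
have iZ k m : mu.-integrable `[0%R, 1%R]
    (fun w => (k * (w ^+ m * expR (- (y * w ^+ 2))))%:E).
  apply: continuous_compact_integrable; first exact: segment_compact.
  apply: continuous_subspaceT => w; apply: cvgM; first exact: cvg_cst.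
  exact: continuous_moment_integrand.
rewrite RintegralB//; [|exact: iZ..].
by rewrite !RintegralZl//; [rewrite subKr|exact: integrable_moment..].
Qed.

(** The case n = -1 of the recursion, where the boundary term at w = 0 is 1 instead of 0. *)
Lemma moment1_rec y : 2 * y * moment 1 y = 1 - expR (- y).
Proof.
have h (w : R) : is_derive w 1 (fun w => - expR (- (y * w ^+ 2)))
    (2 * y * (w ^+ 1 * expR (- (y * w ^+ 2)))).
  by derive_by; rewrite /=; ring.
have := FTC2_cc ltr01 h; rewrite expr1n expr0n/= mulr0 mulr1 oppr0 expR0 opprK addrC => <-.
  by rewrite RintegralZl//; exact: integrable_moment.
move=> w; apply: cvgM; first exact: cvg_cst.
exact: continuous_moment_integrand.
Qed.

Lemma moment_ge0 n y : 0 <= moment n y.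
Proof.
apply: Rintegral_ge0 => // w; rewrite /= in_itv/= => /andP[w0 _].
by rewrite mulr_ge0 ?exprn_ge0 ?expR_ge0.
Qed.

Lemma moment_le1 n y : 0 <= y -> moment n y <= 1.
Proof.
move=> y0; have -> : (1 : R) = \int[mu]_(w in `[0, 1]) (cst 1 w).
  by rewrite Rintegral_cst//= lebesgue_measure_itv/= lte01 oppr0 adde0 mulr1.
apply: le_Rintegral => //.
- exact: integrable_moment.
- apply: continuous_compact_integrable; first exact: segment_compact.
  by apply: continuous_subspaceT => ?; exact: cvg_cst.
move=> w; rewrite /= in_itv/= => /andP[w0 w1].
rewrite mulr_ile1 ?exprn_ge0 ?expR_ge0 ?exprn_ile1// -expR0 ler_expR oppr_le0.
by rewrite mulr_ge0 ?exprn_ge0.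
Qed.

Lemma expRN_le1 y : 0 <= y -> expR (- y) <= 1.
Proof. by move=> y0; rewrite -expR0 ler_expR oppr_le0. Qed.

Lemma mul_expRN_le1 y : 0 <= y -> y * expR (- y) <= 1.
Proof.
move=> y0; rewrite expRN ler_pdivrMr ?expR_gt0// mul1r.
by apply: le_trans (expR_ge1Dx _); rewrite lerDr.
Qed.

Lemma mul_moment2_le1 y : 0 <= y -> y * moment 2 y <= 1.
Proof.
move=> y0; have := moment_rec 0 y; rewrite mul1r.
by have := moment_le1 0 y0; have := expR_ge0 (- y); lra.
Qed.

Lemma mul_moment4_le y : 0 <= y -> y * moment 4 y <= 3 / 2 * moment 2 y.
Proof.
by move=> y0; have := moment_rec 2 y; have := expR_ge0 (- y); lra.
Qed.

(** Substituting s = v w shows that v M_0(a v^2) is the integral of exp(-a s^2) from 0 to v. The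
    recursion for n = 0 gives the derivative without that substitution. *)
Lemma is_derive_mul_moment0 (a v : R) :
  is_derive v 1 (fun v => v * moment 0 (a * v ^+ 2)) (expR (- (a * v ^+ 2))).
Proof.
have h := is_derive_moment 0 (a * v ^+ 2).
have h2 : is_derive v 1 (fun v => a * v ^+ 2) (2 * a * v).
  by derive_by; rewrite /=; ring.
have h3 := is_derive1_funM (is_derive1_funid v) (is_derive1_funchain (g := fun v => a * v ^+ 2) h h2).
apply: (is_derive_eq h3); have := moment_rec 0 (a * v ^+ 2); rewrite mul1r.
by lra.
Qed.

(** This is (sqrt pi / 2) erf v; the moment form is odd in v and covers negative v with no
    convention on reversed intervals. *)
Definition erf0 v : R := v * moment 0 (v ^+ 2).

Lemma is_derive_erf0 v : is_derive v 1 erf0 (expR (- v ^+ 2)).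
Proof.
have -> : erf0 = (fun v => v * moment 0 (1 * v ^+ 2)) by apply/funext => u; rewrite mul1r.
by rewrite -[v ^+ 2]mul1r; exact: is_derive_mul_moment0.
Qed.

Lemma erf0N v : erf0 (- v) = - erf0 v.
Proof. by rewrite /erf0 sqrrN mulNr. Qed.

(** The Gauss integral enters through its square, which tends to pi / 4; positivity allows taking
    the root. *)
Lemma erf0_cvgy : erf0 v @[v --> +oo] --> (Num.sqrt pi / 2 : R).
Proof.
have erfE v : 0 < v -> erf0 v = gauss_integral_proof.integral0_gauss v.
  move=> v0; rewrite /gauss_integral_proof.integral0_gauss.
  rewrite (FTC2_cc v0 is_derive_erf0); last exact: continuous_gauss_fun.
  by rewrite [X in _ - X]/erf0 mul0r subr0.
have : Num.sqrt (@gauss_integral_proof.integral0_gauss R x ^+ 2) @[x --> +oo]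
    --> Num.sqrt (pi / 4).
  apply: continuous_cvg; first exact: sqrt_continuous.
  exact: gauss_integral_proof.cvg_integral0_gauss_sqr.
rewrite sqrtrM ?pi_ge0// sqrtrV// (_ : 4 = 2 ^+ 2); last by rewrite expr2 -natrM.
rewrite sqrtr_sqr ger0_norm//; apply: cvg_trans; apply: near_eq_cvg.
near=> v; have v0 : 0 < v by near: v; exact: nbhs_pinfty_gt.
rewrite sqrtr_sqr erfE// ger0_norm//.
exact: gauss_integral_proof.integral0_gauss_ge0.
Unshelve. all: end_near. Qed.

Lemma erf0_cvgNy : erf0 v @[v --> -oo] --> (- (Num.sqrt pi / 2) : R).
Proof.
apply/cvgNy_compNP; rewrite /comp; under eq_fun do rewrite erf0N.
by apply: cvgN; exact: erf0_cvgy.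
Qed.

End GaussMoments.

Lemma is_derive1_fun_moment {R : realType} n (f : R -> R) (x a : R) : is_derive x 1 f a ->
  is_derive x 1 (fun t => moment n (f t)) (- moment n.+2 (f x) * a).
Proof. exact: is_derive1_funchain (is_derive_moment n (f x)). Qed.

Lemma is_derive1_fun_erf0 {R : realType} (f : R -> R) (x a : R) : is_derive x 1 f a ->
  is_derive x 1 (fun t => erf0 (f t)) (expR (- f x ^+ 2) * a).
Proof. exact: is_derive1_funchain (is_derive_erf0 (f x)). Qed.

Lemma sqrt_cvgy {R : realType} : Num.sqrt t @[t --> (+oo : set_system R)] --> +oo.
Proof.
apply/cvgryPge => A; near=> t.
have A2 : `|A| ^+ 2 <= t by near: t; exact: nbhs_pinfty_ge.
apply: (le_trans (ler_norm A)); rewrite -[leLHS]ger0_norm// -sqrtr_sqr.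
exact: ler_wsqrtr.
Unshelve. all: end_near. Qed.

Lemma erf0_comp_cvgy {R : realType} {F : set_system R} {FF : Filter F} (u : R -> R) :
  u t @[t --> F] --> +oo -> erf0 (u t) @[t --> F] --> (Num.sqrt pi / 2 : R).
Proof. by move=> h; exact: (cvg_comp _ _ h erf0_cvgy). Qed.

Lemma erf0_comp_cvgNy {R : realType} {F : set_system R} {FF : Filter F} (u : R -> R) :
  u t @[t --> F] --> -oo -> erf0 (u t) @[t --> F] --> (- (Num.sqrt pi / 2) : R).
Proof. by move=> h; exact: (cvg_comp _ _ h erf0_cvgNy). Qed.


(** * Gaussian integrals *)

Section ProductSigmaFinite.
Local Open Scope ereal_scope.
Context d1 d2 (T1 : measurableType d1) (T2 : measurableType d2) (R : realType).
Context (m1 : {sigma_finite_measure set T1 -> \bar R})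
  (m2 : {sigma_finite_measure set T2 -> \bar R}).

(* A fresh constant: the library's sigma-finite instance on [m1 \x m2] is shadowed
   by the one for products of subprobabilities. *)
Definition sf_prod : set (T1 * T2) -> \bar R := m1 \x m2.

HB.instance Definition _ := Measure.copy sf_prod (m1 \x m2).

Lemma sigma_finite_sf_prod : sigma_finite setT sf_prod.
Proof.
have /sigma_finiteP[F [TF ndF Foo]] := sigma_finiteT m1.
have /sigma_finiteP[G [TG ndG Goo]] := sigma_finiteT m2.
exists (fun n => F n `*` G n).
  apply/seteqP; split => // -[x y] _.
  have [i _ Fx] : (\bigcup_i F i) x by rewrite -TF.
  have [j _ Gy] : (\bigcup_i G i) y by rewrite -TG.
  exists (maxn i j) => //; split => /=.
    by move: x Fx; apply/subsetPset/ndF/leq_maxl.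
  by move: y Gy; apply/subsetPset/ndG/leq_maxr.
move=> n; have [? ?] := Foo n; have [? ?] := Goo n.
split; first exact: measurableX.
by rewrite [X in X < _]product_measure1E// lte_mul_pinfty// ge0_fin_numE.
Qed.

HB.instance Definition _ := Measure_isSigmaFinite.Build _ _ _ sf_prod
  sigma_finite_sf_prod.

End ProductSigmaFinite.

Section GaussianIntegrals.
Context {R : realType}.
Notation mu := (@lebesgue_measure R).

(** Up to its peak value the integrand is the normal density of mean m and variance 1/(2a). *)
Lemma integral_gauss_shift (a m : R) : 0 < a ->
  (\int[mu]_x (expR (- (a * (x - m) ^+ 2)))%:E = (Num.sqrt (pi / a))%:E)%E.
Proof.
move=> a0; pose s := Num.sqrt (2 * a)^-1.
have s0 : s != 0 by rewrite gt_eqF// sqrtr_gt0 invr_gt0 mulr_gt0.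
have s2 : s ^+ 2 = (2 * a)^-1 by rewrite sqr_sqrtr// invr_ge0 mulr_ge0// ltW.
have k0 : 0 < Num.sqrt (pi / a) by rewrite sqrtr_gt0 divr_gt0// pi_gt0.
have E x : expR (- (a * (x - m) ^+ 2)) = Num.sqrt (pi / a) * normal_pdf m s x.
  rewrite normal_pdfE//= /normal_peak /normal_fun s2.
  rewrite (_ : (2 * a)^-1 * pi *+ 2 = pi / a); last by rewrite -mulr_natr; field; rewrite gt_eqF.
  rewrite mulVKf ?gt_eqF//; congr expR.
  by rewrite -mulr_natr; field; rewrite gt_eqF.
under eq_integral do rewrite E EFinM.
rewrite ge0_integralZl_EFin//.
- by rewrite integral_normal_pdf mule1.
- by move=> x _; rewrite lee_fin normal_pdf_ge0.
- by apply/measurable_EFinP; exact: measurable_normal_pdf.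
Qed.

(** Complete the square in y around a z / (a + b). The case a = 0 is included because a will be l^2
    with l ranging over the whole line. *)
Lemma gauss_convolution (a b z : R) : 0 <= a -> 0 < b ->
  (\int[mu]_y (expR (- (a * (z - y) ^+ 2)) * expR (- (b * y ^+ 2)))%:E =
  (Num.sqrt (pi / (a + b)) * expR (- (a * b / (a + b) * z ^+ 2)))%:E)%E.
Proof.
move=> a0 b0; have ab0 : 0 < a + b by rewrite ltr_wpDl.
have E y : expR (- (a * (z - y) ^+ 2)) * expR (- (b * y ^+ 2)) =
    expR (- (a * b / (a + b) * z ^+ 2)) * expR (- ((a + b) * (y - a * z / (a + b)) ^+ 2)).
  by rewrite -!expRD; congr expR; field; rewrite gt_eqF.
under eq_integral do rewrite E EFinM.
rewrite ge0_integralZl_EFin//; last first.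
  apply/measurable_EFinP; apply: measurableT_comp => //; apply: measurableT_comp => //.
  by apply: measurable_funM => //; apply: measurable_funX; exact: measurable_funB.
by rewrite integral_gauss_shift// -EFinM mulrC.
Qed.

Lemma integral_prod_mul d1 d2 (T1 : measurableType d1) (T2 : measurableType d2)
  (m1 : {sigma_finite_measure set T1 -> \bar R})
  (m2 : {sigma_finite_measure set T2 -> \bar R}) (f : T1 -> R) (g : T2 -> R) (I J : R) :
  measurable_fun setT f -> measurable_fun setT g ->
  (forall x, 0 <= f x) -> (forall x, 0 <= g x) ->
  (\int[m1]_x (f x)%:E = I%:E)%E -> (\int[m2]_x (g x)%:E = J%:E)%E ->
  (\int[m1 \x m2]_p (f p.1 * g p.2)%:E = (I * J)%:E)%E.
Proof.
move=> mf mg f0 g0 fI gJ.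
have J0 : 0 <= J.
  by rewrite -lee_fin -gJ; apply: integral_ge0 => x _; rewrite lee_fin.
rewrite fubini_tonelli1//; last 2 first.
- apply/measurable_EFinP; apply: measurable_funM; exact: measurableT_comp.
- by move=> x; rewrite lee_fin mulr_ge0.
rewrite /fubini_F /=.
under eq_integral => x _.
  under eq_integral do rewrite EFinM.
  rewrite ge0_integralZl_EFin//; last 2 first.
  - by move=> y _; rewrite lee_fin.
  - exact/measurable_EFinP.
  rewrite gJ muleC.
  over.
rewrite ge0_integralZl_EFin//; last 2 first.
- by move=> y _; rewrite lee_fin.
- exact/measurable_EFinP.
by rewrite fI -EFinM mulrC.
Qed.

End GaussianIntegrals.

(** * Convolution of the Newtonian potential with the heat kernel *)

Lemma sum_ord3 (V : nmodType) (F : 'I_3 -> V) : \sum_(i < 3) F i = F 0 + F 1 + F 2.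
Proof.
rewrite !big_ord_recr big_ord0/= add0r.
by congr (F _ + F _ + F _); apply/val_inj.
Qed.

Section Coordinates.
Context {R : realType}.

Lemma enorm_sqr (x : 'cV[R]_3) : enorm x ^+ 2 = \sum_(i < 3) x i 0 ^+ 2.
Proof. by rewrite sqr_sqrtr// sumr_ge0// => i _; exact: sqr_ge0. Qed.

Lemma enormN (x : 'cV[R]_3) : enorm (- x) = enorm x.
Proof. by congr Num.sqrt; apply: eq_bigr => i _; rewrite mxE sqrrN. Qed.

Lemma enorm_ge0 (x : 'cV[R]_3) : 0 <= enorm x.
Proof. exact: sqrtr_ge0. Qed.

Lemma enorm_gt0 (x : 'cV[R]_3) : x != 0 -> 0 < enorm x.
Proof.
rewrite lt_def enorm_ge0 andbT; apply: contraNneq => /(congr1 (fun r => r ^+ 2)).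
rewrite enorm_sqr expr0n/= => /psumr_eq0P x0; apply/eqP/matrixP => i k.
rewrite ord1 mxE; apply/eqP; rewrite -sqrf_eq0; apply/eqP/x0 => // l _.
exact: sqr_ge0.
Qed.

Lemma enorm_sqrE (x : 'cV[R]_3) :
  enorm x ^+ 2 = x 0 0 ^+ 2 + x 1 0 ^+ 2 + x 2 0 ^+ 2.
Proof.
exact: etrans (enorm_sqr x) (sum_ord3 _).
Qed.

Lemma enorm_sub_vec3_sqr (z : 'cV[R]_3) (a b c : R) :
  enorm (z - vec3 a b c) ^+ 2 = (z 0 0 - a) ^+ 2 + (z 1 0 - b) ^+ 2 + (z 2 0 - c) ^+ 2.
Proof. by rewrite enorm_sqrE !mxE. Qed.

Lemma enorm_vec3_sqr (a b c : R) : enorm (vec3 a b c) ^+ 2 = a ^+ 2 + b ^+ 2 + c ^+ 2.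
Proof. by rewrite enorm_sqrE !mxE. Qed.

Lemma eq_vec3 (z : 'cV[R]_3) (a b c : R) :
  z = vec3 a b c -> [/\ a = z 0 0, b = z 1 0 & c = z 2 0].
Proof. by move=> ->; rewrite !mxE. Qed.

End Coordinates.

Section NewtonHeat.
Context {R : realType}.
Notation mu := (@lebesgue_measure R).

(** The integral of exp(-l^2 |u|^2) over l is sqrt pi / |u|. This trades the singular kernel for
    Gaussians, which factor over the coordinates. *)
Lemma newton_gauss (u : 'cV[R]_3) : u != 0 ->
  ((newton u)%:E =
   \int[mu]_l ((4 * pi * Num.sqrt pi)^-1 * expR (- (l ^+ 2 * enorm u ^+ 2)))%:E)%E.
Proof.
move=> u0; have q0 : 0 < enorm u ^+ 2 by rewrite exprn_gt0// enorm_gt0.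
have p0 : 0 < Num.sqrt pi :> R by rewrite sqrtr_gt0 pi_gt0.
have E l : (4 * pi * Num.sqrt pi)^-1 * expR (- (l ^+ 2 * enorm u ^+ 2)) =
    (4 * pi * Num.sqrt pi)^-1 * expR (- (enorm u ^+ 2 * (l - 0) ^+ 2)).
  by rewrite subr0 (mulrC (l ^+ 2)).
under eq_integral do rewrite E EFinM.
rewrite ge0_integralZl_EFin//; last 2 first.
- apply/measurable_EFinP; apply: measurableT_comp => //; apply: measurableT_comp => //.
  by apply: measurable_funM => //; apply: measurable_funX; exact: measurable_funB.
- by rewrite invr_ge0 !mulr_ge0// ?pi_ge0// ltW.
rewrite integral_gauss_shift// -EFinM; congr EFin.
rewrite sqrtrM ?pi_ge0// sqrtrV ?ltW// sqrtr_sqr ger0_norm ?enorm_ge0//.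
rewrite /newton !invfM -!mulrA; do 2 congr *%R.
by rewrite mulKf// gt_eqF.
Qed.

(** With w = l / sqrt(l^2 + b) the exponent becomes - q b w^2 and dw = b (l^2 + b)^(-3/2) dl, so the
    half-line l >= 0 becomes the unit interval of [moment 0]; evenness in l gives the factor 2. The
    substitution is carried out as a primitive, w M_0(q b w^2). *)
Lemma integral_gauss_subordination (b q : R) : 0 < b ->
  (\int[mu]_l (expR (- (l ^+ 2 * b / (l ^+ 2 + b) * q)) *
      Num.sqrt (pi / (l ^+ 2 + b)) ^+ 3)%:E =
   (2 * pi * Num.sqrt pi / b * moment 0 (q * b))%:E)%E.
Proof.
move=> b0.
pose s (l : R) := Num.sqrt (l ^+ 2 + b).
have lb0 l : 0 < l ^+ 2 + b by rewrite ltr_wpDl// sqr_ge0.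
have s0 l : 0 < s l by rewrite sqrtr_gt0.
have s2 l : s l ^+ 2 = l ^+ 2 + b by rewrite sqr_sqrtr// ltW.
pose f (l : R) := expR (- (l ^+ 2 * b / (l ^+ 2 + b) * q)) * Num.sqrt (pi / (l ^+ 2 + b)) ^+ 3.
have dw (l : R) : is_derive l 1 (fun l => l / s l) (b / s l ^+ 3).
  rewrite /s; derive_by; first exact: lb0.
    by rewrite gt_eqF// s0.
  rewrite /= -/(s l); have := s2 l; have := s0 l; set t := s l => t0 t2.
  rewrite (_ : b = t ^+ 2 - l ^+ 2); last by rewrite t2; ring.
  by field; rewrite gt_eqF.
pose F (l : R) := pi * Num.sqrt pi / b * ((l / s l) * moment 0 (q * b * (l / s l) ^+ 2)).
have dF (l : R) : is_derive l 1 F (f l).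
  have h := is_derive1_funchain (g := fun l => l / s l) (is_derive_mul_moment0 (q * b) (l / s l)) (dw l).
  have h' := is_derive1_funM (is_derive1_funcst l (pi * Num.sqrt pi / b)) h.
  apply: (is_derive_val h').
  rewrite /f sqrtrM ?pi_ge0// sqrtrV ?(ltW (lb0 _))// -/(s l) mul0r add0r.
  rewrite (_ : q * b * (l / s l) ^+ 2 = l ^+ 2 * b / (l ^+ 2 + b) * q); last first.
    by rewrite exprMn exprVn s2; ring.
  rewrite [X in X * _ = _](_ : _ = Num.sqrt pi ^+ 3 / b); last first.
    by rewrite exprS sqr_sqrtr ?pi_ge0//; ring.
  by field; rewrite !gt_eqF.
have cf : continuous f.
  move=> l; rewrite /f.
  have [d h] : exists d, is_derive l 1 f d.
    eexists; rewrite /f; derive_rules; rewrite ?divr_gt0 ?pi_gt0//; by rewrite gt_eqF.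
  exact: is_derive_continuous h.
have f0 l : 0 <= f l by rewrite /f mulr_ge0 ?expR_ge0// exprn_ge0.
rewrite (ge0_symfun_integralT f0 cf); last by move=> l; rewrite /f/= sqrrN.
rewrite (_ : [set x | (0 <= x)] = `[0, +oo[%classic); last first.
  by apply/seteqP; split => x/=; rewrite in_itv/= andbT.
rewrite (ge0_continuous_FTC2y (F := F) (l := pi * Num.sqrt pi / b * moment 0 (q * b)))//.
- rewrite [X in (_ - X%:E)%E](_ : _ = 0); last by rewrite /F !mul0r mulr0.
  by rewrite sube0 -EFinM; congr EFin; ring.
- exact: continuous_subspaceT.
- rewrite /F; apply: cvgM; first exact: cvg_cst.
  have w1 : l / s l @[l --> +oo] --> (1 : R).
    have iv : l^-1 @[l --> +oo] --> (0 : R).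
      by apply/gtr0_cvgV0; [exact: nbhs_pinfty_gt|exact: cvg_id].
    have : (Num.sqrt (1 + b * (l^-1 * l^-1)))^-1 @[l --> +oo] --> (Num.sqrt (1 + b * (0 * 0)) : R)^-1.
      apply: cvgV; first by rewrite !mulr0 addr0 sqrtr1 oner_eq0.
      apply: continuous_cvg; first exact: sqrt_continuous.
      apply: cvgD; first exact: cvg_cst.
      by apply: cvgM; [exact: cvg_cst|exact: cvgM].
    rewrite !mulr0 addr0 sqrtr1 invr1; apply: cvg_trans; apply: near_eq_cvg.
    near=> l; have l0 : 0 < l by near: l; exact: nbhs_pinfty_gt.
    rewrite /s (_ : l ^+ 2 + b = l ^+ 2 * (1 + b * (l^-1 * l^-1))); last by field; rewrite gt_eqF.
    rewrite sqrtrM ?sqr_ge0// sqrtr_sqr gtr0_norm//.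
    have x0 : 0 < Num.sqrt (1 + b * (l^-1 * l^-1)).
      by rewrite sqrtr_gt0 ltr_wpDr// mulr_ge0 ?(ltW b0)// mulr_ge0// invr_ge0 ltW.
    by move: x0; set t := Num.sqrt _ => x0; field; rewrite !gt_eqF.
  rewrite -[X in _ --> X]mul1r; apply: cvgM => //.
  rewrite -[X in _ --> moment 0 X]mulr1 -[X in _ --> moment 0 (_ * X)](expr1n _ 2).
  apply: continuous_cvg; first exact: is_derive_continuous (is_derive_moment 0 _).
  apply: cvgM; first exact: cvg_cst.
  by rewrite expr2; under eq_fun do rewrite expr2; exact: cvgM.
- by apply: cvg_at_right_filter; exact: is_derive_continuous (dF 0).
- by move=> l _; exact: is_derive_derive1 (dF l).
Unshelve. all: end_near. Qed.

Lemma measurable_enorm_sub (z : 'cV[R]_3) :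
  measurable_fun setT (fun p : (R * R) * R => enorm (z - vec3 p.1.1 p.1.2 p.2)).
Proof.
have -> : (fun p : (R * R) * R => enorm (z - vec3 p.1.1 p.1.2 p.2)) =
    (fun p => Num.sqrt ((z 0 0 - p.1.1) ^+ 2 + (z 1 0 - p.1.2) ^+ 2 + (z 2 0 - p.2) ^+ 2)).
  apply/funext => p; rewrite -enorm_sub_vec3_sqr sqrtr_sqr ger0_norm//; exact: enorm_ge0.
apply: measurableT_comp.
  by apply: continuous_measurable_fun; exact: sqrt_continuous.
apply: measurable_funD; first apply: measurable_funD; apply: measurable_funX;
  apply: measurable_funB => //; exact: measurableT_comp.
Qed.

(** After [newton_gauss] and Tonelli, the space integral at fixed l is a product of three
    one-dimensional Gaussian convolutions with a = l^2 and b = 1/(4t). The remaining integral over l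
    is the subordination integral with q = |z|^2. *)
Lemma newton_heat_conv (t : R) (z : 'cV[R]_3) : 0 < t ->
  integral_R3 (fun y => newton (z - y) * heat y t) =
  2 * t * (4 * pi * t) `^ (- (3 / 2)) * moment 0 (enorm z ^+ 2 / (4 * t)).
Proof.
move=> t0; set H := (4 * pi * t) `^ (- (3 / 2)).
have H0 : 0 <= H by exact: powR_ge0.
pose b := (4 * t)^-1; have b0 : 0 < b by rewrite invr_gt0 mulr_gt0.
pose k : R := (4 * pi * Num.sqrt pi)^-1.
have p0 : 0 < Num.sqrt pi :> R by rewrite sqrtr_gt0 pi_gt0.
have k0 : 0 <= k by rewrite invr_ge0 !mulr_ge0// ?pi_ge0// ltW.
pose e (i : 'I_3) (l x : R) := expR (- (l ^+ 2 * (z i 0 - x) ^+ 2)) * expR (- (b * x ^+ 2)).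
pose h (q : ((R * R) * R) * R) : R :=
  k * H * (e 0 q.2 q.1.1.1 * e 1 q.2 q.1.1.2 * e 2 q.2 q.1.2).
have e0 i l x : 0 <= e i l x by rewrite mulr_ge0// expR_ge0.
have me d (T : measurableType d) i (f g : T -> R) : measurable_fun setT f ->
    measurable_fun setT g -> measurable_fun setT (fun q => e i (f q) (g q)).
  move=> mf mg; apply: measurable_funM; apply: measurableT_comp => //;
    apply: measurableT_comp => //; apply: measurable_funM => //.
  - exact: measurable_funX.
  - by apply: measurable_funX; exact: measurable_funB.
  - exact: measurable_funX.
have mh : measurable_fun setT h.
  apply: measurable_funM => //; apply: measurable_funM; first apply: measurable_funM;
    apply: me => //; do ?[exact: measurableT_comp];
    by apply: measurableT_comp => //; exact: measurableT_comp.
have h0 q : 0 <= h q by rewrite !mulr_ge0.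
have mEh : measurable_fun setT (EFin \o h) by exact/measurable_EFinP.
have Eh0 q : (0 <= (EFin \o h) q)%E by rewrite lee_fin.
rewrite /integral_R3 /Rintegral.
suff -> : (\int[(mu \x mu) \x mu]_p
   (newton (z - vec3 p.1.1 p.1.2 p.2) * heat (vec3 p.1.1 p.1.2 p.2) t)%:E =
   (2 * t * H * moment 0 (enorm z ^+ 2 / (4 * t)))%:E)%E by [].
have -> : (\int[(mu \x mu) \x mu]_p
   (newton (z - vec3 p.1.1 p.1.2 p.2) * heat (vec3 p.1.1 p.1.2 p.2) t)%:E =
   \int[(mu \x mu) \x mu]_p \int[mu]_l (h (p, l))%:E)%E.
  (* [newton 0 = 0], whereas the Gaussian integral diverges there: the integrands
     only agree away from the null set {z}. *)
  apply: ge0_ae_eq_integral => //.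
  - apply/measurable_EFinP; apply: measurable_funM.
      have -> : (fun p : (R * R) * R => newton (z - vec3 p.1.1 p.1.2 p.2)) =
          (fun p => (4 * pi * enorm (z - vec3 p.1.1 p.1.2 p.2)) `^ (-1)).
        apply/funext => p; rewrite powR_inv1//.
        by rewrite !mulr_ge0// ?pi_ge0// enorm_ge0.
      apply: (measurableT_comp (measurable_powR _)); apply: measurable_funM => //.
      exact: measurable_enorm_sub.
    apply: measurable_funM => //; apply: measurableT_comp => //.
    apply: measurableT_comp => //; apply: measurable_funM => //.
    apply: measurable_funX.
    under eq_fun do rewrite -enormN -sub0r.
    exact: measurable_enorm_sub.
  - exact: (measurable_fun_fubini_tonelli_F (m2 := mu) _ mEh Eh0).
  - move=> p _; rewrite lee_fin mulr_ge0//.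
      by rewrite invr_ge0 !mulr_ge0// ?pi_ge0// enorm_ge0.
    by rewrite mulr_ge0 ?expR_ge0.
  - by move=> p _; apply: integral_ge0 => l _; rewrite lee_fin.
  - exists ([set z 0 0] `*` [set z 1 0] `*` [set z 2 0]); split.
    + by apply: measurableX => //; exact: measurableX.
    + apply: (eq_trans (product_measure1E (mu \x mu)%E mu _ _)) => //.
        exact: measurableX.
      exact: (etrans (congr1 (fun r => (_ * r)%E) (lebesgue_measure_set1 _)) (mule0 _)).
    + move=> [[x1 x2] x3] /= /not_implyP [_ ne] /=.
      apply: contrapT => neq; apply: ne.
      have u0 : z - vec3 x1 x2 x3 != 0.
        apply/eqP => /subr0_eq /eq_vec3[h1 h2 h3]; by apply: neq; rewrite h1 h2 h3.
      rewrite EFinM newton_gauss// muleC.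
      rewrite -ge0_integralZl_EFin//.
      - apply: eq_integral => l _; rewrite -EFinM; congr EFin.
        rewrite /h /e /heat -/H enorm_sub_vec3_sqr enorm_vec3_sqr -/k.
        rewrite -/b (_ : expR (- ((x1 ^+ 2 + x2 ^+ 2 + x3 ^+ 2) * b)) =
          expR (- (b * x1 ^+ 2)) * expR (- (b * x2 ^+ 2)) * expR (- (b * x3 ^+ 2))); last first.
          by rewrite -!expRD; congr expR; ring.
        rewrite (_ : expR (- (l ^+ 2 * _)) = expR (- (l ^+ 2 * (z 0 0 - x1) ^+ 2)) *
          expR (- (l ^+ 2 * (z 1 0 - x2) ^+ 2)) * expR (- (l ^+ 2 * (z 2 0 - x3) ^+ 2))); last first.
          by rewrite -!expRD; congr expR; ring.
        by rewrite /=; ring.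
      - by move=> l _; rewrite lee_fin mulr_ge0// expR_ge0.
      - apply/measurable_EFinP; apply: measurable_funM => //.
        apply: measurableT_comp => //; apply: measurableT_comp => //.
        by apply: measurable_funM => //; exact: measurable_funX.
      - by rewrite mulr_ge0// expR_ge0.
apply: (eq_trans (fubini_tonelli (m1 := sf_prod (sf_prod mu mu) mu) (m2 := mu) _ mEh Eh0)).
pose c i (l : R) := Num.sqrt (pi / (l ^+ 2 + b)) *
  expR (- (l ^+ 2 * b / (l ^+ 2 + b) * z i 0 ^+ 2)).
have ce i l : (\int[mu]_x (e i l x)%:E = (c i l)%:E)%E.
  by rewrite gauss_convolution// sqr_ge0.
have mei i l : measurable_fun setT (e i l) by exact: (me _ _ i (cst l) id).
transitivity (\int[mu]_l ((k * H)%:E * (c 0 l * c 1 l * c 2 l)%:E))%E.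
  apply: eq_integral => l _; rewrite /h /=.
  under eq_integral do rewrite EFinM.
  rewrite ge0_integralZl_EFin//.
  - congr (_ * _)%E.
    apply: (@integral_prod_mul _ _ _ _ _ (sf_prod mu mu) mu (fun p => e 0 l p.1 * e 1 l p.2) (e 2 l)) => //.
    + by apply: measurable_funM; apply: (measurableT_comp (mei _ _)).
    + exact: mei.
    + by move=> p; rewrite mulr_ge0.
    + by apply: (@integral_prod_mul _ _ _ _ _ mu mu (e 0 l) (e 1 l)) => //; exact: mei.
  - by move=> p _; rewrite lee_fin !mulr_ge0.
  - apply/measurable_EFinP; apply: measurable_funM; last exact: (measurableT_comp (mei _ _)).
    by apply: measurable_funM; apply: (measurableT_comp (mei _ _)); exact: measurableT_comp.
  - exact: mulr_ge0.
have mc i : measurable_fun setT (c i).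
  apply: continuous_measurable_fun => l.
  have lb : 0 < l ^+ 2 + b by rewrite ltr_wpDl// sqr_ge0.
  have [d dc] : exists d, is_derive l 1 (c i) d.
    eexists; rewrite /c; derive_rules; rewrite ?divr_gt0 ?pi_gt0//; by rewrite gt_eqF.
  exact: is_derive_continuous dc.
rewrite ge0_integralZl_EFin//; last 3 first.
- by move=> l _; rewrite lee_fin /c !mulr_ge0// ?expR_ge0.
- apply/measurable_EFinP; apply: measurable_funM; last exact: mc.
  by apply: measurable_funM; exact: mc.
- exact: mulr_ge0.
have cE l : c 0 l * c 1 l * c 2 l =
    expR (- (l ^+ 2 * b / (l ^+ 2 + b) * enorm z ^+ 2)) * Num.sqrt (pi / (l ^+ 2 + b)) ^+ 3.
  rewrite /c enorm_sqrE 2!mulrDr 2!opprD 2!expRD; ring.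
under eq_integral do rewrite cE.
rewrite integral_gauss_subordination// -EFinM; congr EFin.
rewrite /k /b invrK; move: p0 (@pi_gt0 R); generalize (@pi R) => P p0 P0.
by field; rewrite !gt_eqF.
Qed.

End NewtonHeat.

(** * The matrix exponential and the derivatives of the convolution *)

Section Expmx.
Context {R : realType}.
Implicit Types (A B : 'M[R]_3).

Lemma mx_norm_le A (c : R) : 0 <= c -> (forall i j, `|A i j| <= c) -> `|A| <= c.
Proof.
move=> c0 Ac; rewrite [leLHS]/Num.norm/= mx_normrE.
by apply/bigmax_leP; split => // -[i j] _; exact: Ac.
Qed.

Lemma coord_le_mx_norm A i j : `|A i j| <= `|A|.
Proof.
rewrite [leRHS]/Num.norm/= mx_normrE.
exact: (le_bigmax _ (fun ij : 'I_3 * 'I_3 => `|A ij.1 ij.2|) (i, j)).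
Qed.

(** The norm is the largest entry, hence submultiplicative only up to the number 3 of summands in an
    entry of the product. *)
Lemma mx_normM A B : `|A *m B| <= 3 * `|A| * `|B|.
Proof.
apply: mx_norm_le => [|i j]; first by rewrite !mulr_ge0.
rewrite mxE; apply: (le_trans (ler_norm_sum _ _ _)).
have -> : 3 * `|A| * `|B| = \sum_(k < 3) `|A| * `|B|.
  by rewrite sumr_const card_ord -mulrA mulr_natl.
by apply: ler_sum => k _; rewrite normrM ler_pM// coord_le_mx_norm.
Qed.

Lemma mx_normX A n : `|A ^+ n| <= (3 * `|A|) ^+ n.
Proof.
elim: n => [|n ih].
  rewrite !expr0; apply: mx_norm_le => // i j; rewrite mxE normr_nat.
  by case: (i == j).
rewrite !exprS; apply: (le_trans (mx_normM _ _)).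
by rewrite ler_wpM2l// mulr_ge0.
Qed.

(** Normwise comparison with the series of exp(3 |A|). The [limn] in [expmx] carries information
    only once convergence is known. *)
Lemma cvg_expmx A : cvgn (series (fun n => (n`!%:R)^-1 *: A ^+ n)).
Proof.
have : cvgn (series (fun n => `|(n`!%:R)^-1 *: A ^+ n|)).
  apply: (@series_le_cvg _ _ (exp_coeff (3 * `|A|))) => //.
  - by move=> n; rewrite /exp_coeff /= divr_ge0// exprn_ge0// mulr_ge0.
  - move=> n; rewrite /exp_coeff /= normrZ ger0_norm ?invr_ge0//.
    by rewrite mulrC ler_wpM2r ?invr_ge0// mx_normX.
  - exact: is_cvg_series_exp_coeff.
move=> /cauchy_cvgP/cauchy_seriesP ncvg.
apply/cauchy_cvgP/cauchy_seriesP => e /ncvg.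
apply: filterS => n /=; rewrite ger0_norm ?sumr_ge0//.
by apply: le_lt_trans; exact: ler_norm_sum.
Qed.

(** Every power A^n with n >= 1 inherits the zero column, so only the identity term contributes to
    it. *)
Lemma expmx_col0 A : (forall k, A k 0 = 0) -> forall k, expmx A k 0 = (k == 0)%:R.
Proof.
move=> A0 k; have hA := @cvg_expmx A.
have h : (series (fun n => (n`!%:R)^-1 *: A ^+ n) n : 'M[R]_3) k 0 @[n --> \oo] --> expmx A k 0.
  apply: (@continuous_cvg _ _ _ _ _ _ (fun M : 'M[R]_3 => M k 0)); last exact: hA.
  exact: coord_continuous.
apply: (cvg_unique _ h) => //.
(* The partial sum of index 0 is empty; the column is constant from index 1 on. *)
apply: cvg_near_cst; exists 1%N => // -[//|n] _.
rewrite /series /= big_nat_recl//= mxE.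
rewrite fact0 invr1 expr0 scale1r.
rewrite summxE big1 ?addr0 ?mxE// => i _; rewrite mxE exprSr mxE big1 ?mulr0// => l _.
by rewrite A0 mulr0.
Qed.

End Expmx.

(** * Partial derivatives as derivatives along coordinate lines *)

Section Lines.
Context {R : realType}.
Implicit Types (x : 'cV[R]_3) (j k : 'I_3).

(** Reduces every partial derivative to one real variable. Agreement near 0 suffices, which matters
    where a formula for f holds only off the origin. *)
Lemma partial_line (f : 'cV[R]_3 -> R) x j (g : R -> R) (d : R) :
  (\forall h \near (0 : R), f (h *: delta_mx j 0 + x) = g h) ->
  is_derive (0 : R) (1 : R) g d -> partial j f x = d.
Proof.
move=> fg [dg <-]; rewrite /partial /derive; congr (lim _).
have f0 : f x = g 0 by have := nbhs_singleton fg; rewrite scale0r add0r.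
have fg' : \forall h \near 0^', f (h *: delta_mx j 0 + x) = g h.
  exact: (@cvg_within _ (nbhs (0 : R)) _ _ _ fg).
rewrite eqEsubset; split; apply: near_eq_cvg; apply: filterS fg' => h /= e;
  by rewrite /shift/= addr0 e f0 -[h *: 1]/(h * 1) mulr1.
Qed.

Lemma line_coord x j k (h : R) :
  (h *: delta_mx j 0 + x) k 0 = x k 0 + h * (k == j)%:R.
Proof. by rewrite !mxE eqxx andbT addrC. Qed.

Lemma enorm_line x j (h : R) :
  enorm (h *: delta_mx j 0 + x) ^+ 2 = enorm x ^+ 2 + 2 * x j 0 * h + h ^+ 2.
Proof.
rewrite !enorm_sqr -addrA.
transitivity (\sum_(i < 3) (x i 0 ^+ 2 + (if i == j then 2 * x j 0 * h + h ^+ 2 else 0))).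
  apply: eq_bigr => i _; rewrite line_coord; case: eqP => [->|_]; rewrite /= ?mulr1n ?mulr0n; ring.
by rewrite big_split/= -big_mkcond/= big_pred1_eq.
Qed.

End Lines.

Section HeatDerivatives.
Context {R : realType}.
Implicit Types (x z : 'cV[R]_3) (j k : 'I_3).

Lemma partial_newton_heat (t : R) (k : 'I_3) z : 0 < t ->
  partial k (fun z => integral_R3 (fun y => newton (z - y) * heat y t)) z =
  - ((4 * pi * t) `^ (- (3 / 2)) * z k 0 * moment 2 (enorm z ^+ 2 / (4 * t))).
Proof.
move=> t0; set H := (4 * pi * t) `^ (- (3 / 2)).
pose q (h : R) := (enorm z ^+ 2 + 2 * z k 0 * h + h ^+ 2) / (4 * t).
apply: (@partial_line _ _ _ _ (fun h => 2 * t * H * moment 0 (q h))).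
  by near=> h; rewrite newton_heat_conv// enorm_line.
have dq : is_derive (0 : R) 1 q (2 * z k 0 / (4 * t)).
  by rewrite /q; derive_by; rewrite /=; ring.
have h := is_derive1_funM (is_derive1_funcst 0 (2 * t * H))
  (is_derive1_fun_moment 0 dq).
apply: (is_derive_val h); rewrite mul0r add0r /q mulr0 expr0n/= !addr0.
by field; rewrite gt_eqF.
Unshelve. all: end_near. Qed.

Lemma TE (t : R) j k z : 0 < t ->
  T z t j k = (4 * pi * t) `^ (- (3 / 2)) *
    ((j == k)%:R * (expR (- (enorm z ^+ 2 / (4 * t))) - moment 2 (enorm z ^+ 2 / (4 * t)))
     + z j 0 * z k 0 / (2 * t) * moment 4 (enorm z ^+ 2 / (4 * t))).
Proof.
move=> t0; rewrite mxE /heat; set H := (4 * pi * t) `^ (- (3 / 2)).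
pose q (h : R) := (enorm z ^+ 2 + 2 * z j 0 * h + h ^+ 2) / (4 * t).
rewrite (_ : partial k _ = fun z =>
    - (H * z k 0 * moment 2 (enorm z ^+ 2 / (4 * t)))); last first.
  by apply/funext => w; exact: partial_newton_heat.
rewrite (_ : partial j _ z = - (H * ((j == k)%:R * moment 2 (enorm z ^+ 2 / (4 * t))
  - z k 0 * (z j 0 / (2 * t) * moment 4 (enorm z ^+ 2 / (4 * t)))))); first by ring.
apply: (@partial_line _ _ _ _ (fun h => - (H * (z k 0 + h * (j == k)%:R) * moment 2 (q h)))).
  by near=> h; rewrite enorm_line line_coord eq_sym.
have dq : is_derive (0 : R) 1 q (2 * z j 0 / (4 * t)).
  by rewrite /q; derive_by; rewrite /=; ring.
have h1 : is_derive (0 : R) 1 (fun h => H * (z k 0 + h * (j == k)%:R)) (H * (j == k)%:R).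
  by derive_by; rewrite /=; ring.
have h := is_derive1_funN (is_derive1_funM h1 (is_derive1_funchain (is_derive_moment 2 (q 0)) dq)).
apply: (is_derive_val h); rewrite /q mulr0 expr0n/= mul0r !addr0.
by field; rewrite gt_eqF.
Unshelve. all: end_near. Qed.

End HeatDerivatives.

(** * The fundamental solution *)

Section Psi.
Context {R : realType}.
Notation mu := (@lebesgue_measure R).
Implicit Types (x y r s : R).

Let g t : R := 2 * moment 1 t.

Let cg : continuous g.
Proof.
move=> t; apply: cvgM; first exact: cvg_cst.
exact: is_derive_continuous (is_derive_moment 1 t).
Qed.

Let ig a b : mu.-integrable `[a, b] (EFin \o g).
Proof.
apply: continuous_compact_integrable; first exact: segment_compact.
exact: continuous_subspaceT.
Qed.

(** At t = 0 the left side is 0, because 0^-1 = 0, whereas g 0 = 1; g is the continuous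
    extension. *)
Let gE t : t != 0 -> (1 - expR (- t)) * t^-1 = g t.
Proof. by move=> t0; rewrite -moment1_rec /g mulrAC mulfK. Qed.

(** The base point -1 puts 0 in the interior, so that the fundamental theorem yields a two-sided
    derivative there. *)
Let P r : R := \int[mu]_(t in `[-1, r]) g t.

Let psiE r : -1 < r -> psi r = P r - P 0.
Proof.
move=> r1.
have N10 : -1 <= 0 :> R by lra.
have iphi (D : set R) : measurable D -> ~ D 0 -> mu.-integrable D (EFin \o g) ->
    mu.-integrable D (EFin \o (fun t => (1 - expR (- t)) * t^-1)).
  move=> mD D0; apply: eq_integrable => // t; rewrite inE => Dt /=.
  by rewrite gE//; apply: contra_notN D0 => /eqP <-.
rewrite /psi; case: (leP 0 r) => r0.
  rewrite /P (Rintegral_itvB (ig _ _)) ?bnd_simp//.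
  have igr : mu.-integrable `]0, r] (EFin \o g).
    by apply: integrableS (ig 0 r) => //; exact: subset_itv_oc_cc.
  (* The endpoint 0, the only point where the two integrands differ, is removed from the
     interval. *)
  rewrite -Rintegral_itv_obnd_cbnd; last first.
    by apply: iphi => //=; rewrite in_itv/= ltxx.
  apply: eq_Rintegral => t; rewrite inE/= in_itv/= => /andP[t0 _].
  by rewrite gE// gt_eqF.
apply: oppr_inj; rewrite opprK opprB.
rewrite /P (Rintegral_itvB (ig _ _)) ?bnd_simp ?(ltW r0) ?(ltW r1)//.
rewrite [RHS]Rintegral_itv_obnd_cbnd; last first.
  by apply: integrableS (ig r 0) => //; exact: subset_itv_oc_cc.
have igr : mu.-integrable `[r, 0[ (EFin \o g).
  by apply: integrableS (ig r 0) => //; exact: subset_itv_co_cc.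
rewrite -[RHS]Rintegral_itv_bndo_bndc// -[LHS]Rintegral_itv_bndo_bndc; last first.
  by apply: iphi => //=; rewrite in_itv/= ltxx andbF.
apply: eq_Rintegral => t; rewrite inE/= in_itv/= => /andP[_ t0].
by rewrite gE// lt_eqF.
Qed.

(** In [Phi] the argument of [psi] is never negative, but it is 0 when x = |x| e_1, and the chain
    rule still asks for a two-sided derivative there. *)
Lemma is_derive_psi s : 0 <= s -> is_derive s 1 (@psi R) (2 * moment 1 s).
Proof.
move=> s0.
have [dP PE] : derivable P s 1 /\ (derive1 P) s = g s.
  apply: (@continuous_FTC1 R g (BLeft (-1)) s (s + 1)).
  - by rewrite ltrDl.
  - exact: ig.
  - by rewrite lte_fin; lra.
  - exact: cg.
have hP : is_derive s 1 (fun r => P r - P 0) (g s - 0).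
  have dPs : is_derive s 1 P (g s).
    by rewrite -PE; apply: DeriveDef; [exact: dP|rewrite derive1E].
  exact: (is_derive1_funB dPs (is_derive1_funcst s (P 0))).
rewrite subr0 in hP; apply: near_eq_is_derive hP.
near=> r; apply/esym/psiE.
by near: r; apply: (@lt_nbhsr _ (-1) s); lra.
Unshelve. all: end_near. Qed.

End Psi.

(** * Derivatives of the potential and the closed form of the first column of E *)

Section PhiDerivatives.
Context {R : realType}.
Implicit Types (x : 'cV[R]_3) (j k : 'I_3).

Definition wake (tau : R) x := tau * (enorm x - x 0 0) / 2.

Lemma coord_le_enorm x j : x j 0 <= enorm x.
Proof.
apply: (le_trans (ler_norm _)); rewrite -sqrtr_sqr ler_wsqrtr//.
by rewrite (bigD1 j)//= lerDl sumr_ge0// => i _; exact: sqr_ge0.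
Qed.

Lemma wake_ge0 tau x : 0 < tau -> 0 <= wake tau x.
Proof.
by move=> t0; rewrite divr_ge0// mulr_ge0 ?(ltW t0)// subr_ge0 coord_le_enorm.
Qed.

Definition enorm_line_fun x j (h : R) : R := Num.sqrt (enorm x ^+ 2 + 2 * x j 0 * h + h ^+ 2).

Lemma enorm_lineE x j h : enorm (h *: delta_mx j 0 + x) = enorm_line_fun x j h.
Proof. by rewrite /enorm_line_fun -enorm_line sqrtr_sqr ger0_norm// enorm_ge0. Qed.

Lemma enorm_line0 x j : enorm_line_fun x j 0 = enorm x.
Proof. by rewrite -enorm_lineE scale0r add0r. Qed.

Lemma is_derive_enorm_line x j : x != 0 ->
  is_derive (0 : R) 1 (enorm_line_fun x j) (x j 0 / enorm x).
Proof.
move=> x0; have r0 := enorm_gt0 x0; rewrite /enorm_line_fun; derive_by.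
  by rewrite mulr0 expr0n/= !addr0 exprn_gt0.
rewrite /= -/(enorm_line_fun x j 0) enorm_line0.
by field; rewrite gt_eqF.
Qed.

Lemma is_derive_wake_line (tau : R) x j : x != 0 ->
  is_derive (0 : R) 1 (fun h => tau * (enorm_line_fun x j h - (x 0 0 + h * (j == 0)%:R)) / 2)
    (tau / 2 * (x j 0 / enorm x - (j == 0)%:R)).
Proof.
move=> x0; have hr := is_derive_enorm_line j x0.
by derive_by; rewrite /=; ring.
Qed.

Lemma wake_lineE (tau : R) x j h : wake tau (h *: delta_mx j 0 + x) =
  tau * (enorm_line_fun x j h - (x 0 0 + h * (j == 0)%:R)) / 2.
Proof. by rewrite /wake enorm_lineE line_coord eq_sym. Qed.

Lemma partial_Phi (tau : R) x k : 0 < tau -> x != 0 ->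
  partial k (Phi tau) x =
  (4 * pi)^-1 * (moment 1 (wake tau x) * (x k 0 / enorm x - (k == 0)%:R)).
Proof.
move=> t0 x0.
pose s (h : R) := tau * (enorm_line_fun x k h - (x 0 0 + h * (k == 0)%:R)) / 2.
have s0 : s 0 = wake tau x by rewrite /s -wake_lineE scale0r add0r.
apply: (@partial_line _ _ _ _ (fun h => (4 * pi * tau)^-1 * psi (s h))).
  by near=> h; rewrite /Phi -/(wake tau _) wake_lineE.
have hpsi : is_derive (s 0) 1 (@psi R) (2 * moment 1 (s 0)).
  by apply: is_derive_psi; rewrite s0; exact: wake_ge0.
have h := is_derive1_funM (is_derive1_funcst 0 (4 * pi * tau)^-1)
  (is_derive1_funchain hpsi (is_derive_wake_line tau k x0)).
apply: (is_derive_val h); rewrite mul0r add0r s0.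
have := @pi_gt0 R; generalize (@pi R) => p p0.
by field; rewrite !gt_eqF ?enorm_gt0.
Unshelve. all: end_near. Qed.

(** The first partials are known only off the origin; differentiating them again requires nearby
    points of the line to avoid it. *)
Lemma near_line_neq0 x j : x != 0 -> \forall h \near (0 : R), h *: delta_mx j 0 + x != 0.
Proof.
move=> x0; have c : {for (0 : R), continuous (enorm_line_fun x j)}.
  exact: is_derive_continuous (is_derive_enorm_line j x0).
have : 0 < enorm_line_fun x j 0 by rewrite enorm_line0 enorm_gt0.
move=> /(cvgr_gt _ c); apply: filterS => h; rewrite -enorm_lineE.
by apply: contraTneq => ->; rewrite /enorm big1 ?sqrtr0 ?ltxx// => i _; rewrite mxE expr0n.
Qed.

Lemma partial2_Phi (tau : R) x j k : 0 < tau -> x != 0 ->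
  partial j (partial k (Phi tau)) x =
  (4 * pi)^-1 * (moment 1 (wake tau x) * ((j == k)%:R / enorm x - x j 0 * x k 0 / enorm x ^+ 3)
    - moment 3 (wake tau x) * (tau / 2) * (x j 0 / enorm x - (j == 0)%:R) *
        (x k 0 / enorm x - (k == 0)%:R)).
Proof.
move=> t0 x0; have r0 := enorm_gt0 x0.
pose s (h : R) := tau * (enorm_line_fun x j h - (x 0 0 + h * (j == 0)%:R)) / 2.
have s0 : s 0 = wake tau x by rewrite /s -wake_lineE scale0r add0r.
apply: (@partial_line _ _ _ _ (fun h => (4 * pi)^-1 * (moment 1 (s h) *
   ((x k 0 + h * (j == k)%:R) / enorm_line_fun x j h - (k == 0)%:R)))).
  near=> h; rewrite partial_Phi//; last by near: h; exact: near_line_neq0.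
  by rewrite wake_lineE enorm_lineE line_coord (eq_sym j k).
have hm := is_derive1_funchain (is_derive_moment 1 (s 0)) (is_derive_wake_line tau j x0).
have hr := is_derive_enorm_line j x0.
have hq : is_derive (0 : R) 1 (fun h => (x k 0 + h * (j == k)%:R) / enorm_line_fun x j h - (k == 0)%:R)
    ((j == k)%:R / enorm x - x j 0 * x k 0 / enorm x ^+ 3).
  derive_by; first by rewrite enorm_line0 gt_eqF.
  by rewrite /= enorm_line0; field; rewrite gt_eqF.
have h := is_derive1_funM (is_derive1_funcst 0 (4 * pi)^-1) (is_derive1_funM hm hq).
apply: (is_derive_val h); rewrite mul0r add0r -/(s 0) s0 enorm_line0 mul0r addr0; ring.
Unshelve. all: end_near. Qed.

Lemma E_col0 (tau : R) x j : 0 < tau -> x != 0 ->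
  E tau j 0 x = (4 * pi)^-1 * (expR (- wake tau x) *
     ((j == 0)%:R / (2 * enorm x) + x j 0 / (2 * enorm x ^+ 2) + x j 0 / (tau * enorm x ^+ 3))
    - x j 0 / (tau * enorm x ^+ 3)).
Proof.
move=> t0 x0; have r0 := enorm_gt0 x0.
have nz : enorm x != 0 by rewrite gt_eqF.
have tz : tau != 0 by rewrite gt_eqF.
set s := wake tau x; set e := expR (- s).
have m1 := moment1_rec s; have m3 := moment_rec 1 s; rewrite -/e in m1 m3.
have x00 : x 0 0 = enorm x - 2 * s / tau by rewrite /s /wake; field.
have lap : laplacian (Phi tau) x = (4 * pi)^-1 * (e / enorm x).
  rewrite /laplacian; under eq_bigr do rewrite partial2_Phi// -/s.
  rewrite -mulr_sumr; congr (_ * _).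
  rewrite sum_ord3 /= !mulr1n !mulr0n.
  transitivity (moment 1 s * (3 / enorm x - (x 0 0 ^+ 2 + x 1 0 ^+ 2 + x 2 0 ^+ 2) / enorm x ^+ 3)
    - moment 3 s * (tau / 2) * ((x 0 0 ^+ 2 + x 1 0 ^+ 2 + x 2 0 ^+ 2) / enorm x ^+ 2
        - 2 * x 0 0 / enorm x + 1)); first by field.
  rewrite -enorm_sqrE x00 (_ : e = 2 * moment 1 s - 2 * s * moment 3 s); last by rewrite m3; ring.
  by field; rewrite nz tz.
have sm1 : s * moment 1 s = (1 - e) / 2 by lra.
have sm3 : s * moment 3 s = moment 1 s - e / 2 by lra.
rewrite /E lap partial2_Phi// -/s x00 eqxx mulr1n mulrCA -mulrBr; congr (_ * _).
set d := (j == 0)%:R.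
(* With x_1 = |x| - 2 s / tau the moments occur as M_1, s M_1 and s M_3. The recursions replace s
   M_1 and s M_3 without dividing by s, and the remaining multiples of M_1 cancel. *)
transitivity (d * e / enorm x - (moment 1 s * (d / enorm x - x j 0 / enorm x ^+ 2)
   + s * moment 1 s * (2 * x j 0 / (tau * enorm x ^+ 3))
   + s * moment 3 s * ((x j 0 / enorm x - d) / enorm x))).
  by field; rewrite nz tz.
by rewrite sm1 sm3; field; rewrite nz tz.
Qed.

End PhiDerivatives.

(** * The time integral *)

Section TimeIntegral.
Context {R : realType}.
Notation mu := (@lebesgue_measure R).
Variables (tau : R) (x : 'cV[R]_3) (j : 'I_3).
Hypotheses (tau_gt0 : 0 < tau) (x_neq0 : x != 0).

(** Quantities along the path x - tau t e_1: q is its squared norm, y the argument of the moments, z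
    its j-th coordinate. The constant c is (4 pi)^(-3/2). *)
Let r := enorm x.
Let d : R := (j == 0)%:R.
Let c : R := (8 * pi * Num.sqrt pi)^-1.
Let x0 := x 0 0.
Let xj := x j 0.
Let q (t : R) := r ^+ 2 - 2 * tau * t * x0 + (tau * t) ^+ 2.
Let y (t : R) := q t / (4 * t).
Let z (t : R) := xj - tau * t * d.

Let r_gt0 : 0 < r. Proof. exact: enorm_gt0. Qed.
Let pi0 : 0 < pi :> R. Proof. exact: pi_gt0. Qed.
Let sqrtpi0 : 0 < Num.sqrt pi :> R. Proof. by rewrite sqrtr_gt0. Qed.
Let c_gt0 : 0 < c. Proof. by rewrite invr_gt0 !mulr_gt0. Qed.
Let d01 : (d == 0) || (d == 1).
Proof. by rewrite /d; case: (j == 0); rewrite eqxx ?orbT. Qed.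

Let H_E (t : R) : 0 < t -> (4 * pi * t) `^ (- (3 / 2)) = c / Num.sqrt t ^+ 3.
Proof.
move=> t0; have u0 : 0 <= 4 * pi * t by rewrite !mulr_ge0// ltW.
rewrite powRN (_ : 3 / 2 = 2^-1 * 3%:R); last by rewrite mulrC.
rewrite powRrM powR12_sqrt// powR_mulrn// !sqrtrM ?mulr_ge0 ?(ltW pi0)//.
rewrite (_ : 4 = 2 ^+ 2 :> R); last by rewrite expr2 -natrM.
rewrite sqrtr_sqr ger0_norm// !exprMn invfM /c; congr (_ / _); congr (_^-1).
by rewrite (exprS (Num.sqrt pi)) sqr_sqrtr ?(ltW pi0)//; ring.
Qed.

Let zt (t : R) : x - (tau * t) *: e1 R = x - (tau * t) *: delta_mx 0 0.
Proof.
congr (x - _ *: _); apply/matrixP => i k; rewrite ord1 !mxE eqxx andbT.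
by case: i => [[|[|[|]]]].
Qed.

Let z_coord t k : (x - (tau * t) *: e1 R) k 0 = x k 0 - tau * t * (k == 0)%:R.
Proof. by rewrite zt !mxE eqxx andbT. Qed.

Let q_E (t : R) : enorm (x - (tau * t) *: e1 R) ^+ 2 = q t.
Proof.
by rewrite zt addrC -scaleNr enorm_line /q -/r -/x0; ring.
Qed.

Definition Oseen_kernel (t : R) : R := c / Num.sqrt t ^+ 3 *
  (d * (expR (- y t) - moment 2 (y t)) + z t * (x0 - tau * t) / (2 * t) * moment 4 (y t)).

Lemma GammaE (rho t : R) : 0 < t -> Gamma tau rho x 0 t j 0 = Oseen_kernel t.
Proof.
move=> t0; rewrite /Gamma mulmx0 subr0 mxE.
have O0 k : (- t *: Omega rho : 'M[R]_3) k 0 = 0.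
  by rewrite !mxE; case: k => [[|[|[|]]]]//=; rewrite !mulr0.
rewrite (bigD1 0)//= expmx_col0// eqxx mulr1 big1 ?addr0; last first.
  by move=> k /negPf k0; rewrite expmx_col0// k0 mulr0.
by rewrite (TE _ _ _ t0) (H_E t0) q_E (z_coord t j) (z_coord t 0) eqxx mulr1.
Qed.

(** * An integrable majorant of the kernel *)

(** The reverse triangle inequality, squared: the path stays away from the origin for small t and
    escapes linearly for large t. *)
Let q_ge (t : R) : 0 <= t -> (tau * t - r) ^+ 2 <= q t.
Proof.
move=> t0; rewrite -subr_ge0.
have -> : q t - (tau * t - r) ^+ 2 = 2 * (tau * t) * (r - x0) by rewrite /q; ring.
by rewrite !mulr_ge0 ?(ltW tau_gt0)// subr_ge0 coord_le_enorm.
Qed.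

Let q_ge0 (t : R) : 0 <= q t. Proof. by rewrite -q_E exprn_ge0// enorm_ge0. Qed.

Let y_ge0 (t : R) : 0 < t -> 0 <= y t.
Proof. by move=> t0; rewrite divr_ge0// mulr_ge0// ltW. Qed.

Let z_le (t : R) : z t ^+ 2 <= q t.
Proof.
rewrite -q_E enorm_sqr (_ : z t = (x - (tau * t) *: e1 R) j 0); last by rewrite z_coord.
by rewrite (bigD1 j)//= lerDl sumr_ge0// => i _; exact: sqr_ge0.
Qed.

Let z0_le (t : R) : (x0 - tau * t) ^+ 2 <= q t.
Proof.
rewrite -q_E enorm_sqr (_ : x0 - tau * t = (x - (tau * t) *: e1 R) 0 0); last by rewrite z_coord eqxx mulr1.
by rewrite (bigD1 0)//= lerDl sumr_ge0// => i _; exact: sqr_ge0.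
Qed.

(** Bounds the bracket in the kernel: the diagonal term is at most exp(-y) + M_2, and the other at
    most 2 y M_4 <= 3 M_2, as both coordinates are at most sqrt q in absolute value. Since exp(-y),
    M_2 and their products with y are at most 1, both m and y m are at most 5. *)
Let m (t : R) := expR (- y t) + 4 * moment 2 (y t).

Let m_le5 (t : R) : 0 < t -> m t <= 5.
Proof.
move=> t0; have := moment_le1 2 (y_ge0 t0); have := expRN_le1 (y_ge0 t0).
by rewrite /m; lra.
Qed.

Let ym_le5 (t : R) : 0 < t -> y t * m t <= 5.
Proof.
move=> t0; have := mul_moment2_le1 (y_ge0 t0); have := mul_expRN_le1 (y_ge0 t0).
by rewrite /m; lra.
Qed.

Let kernel_le_m (t : R) : 0 < t -> `|Oseen_kernel t| <= c / Num.sqrt t ^+ 3 * m t.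
Proof.
move=> t0; have s0 : 0 < Num.sqrt t by rewrite sqrtr_gt0.
have y0 := y_ge0 t0.
rewrite /Oseen_kernel normrM ger0_norm ?divr_ge0 ?(ltW c_gt0) ?exprn_ge0//.
rewrite ler_wpM2l ?divr_ge0 ?(ltW c_gt0) ?exprn_ge0//.
have m2 := moment_ge0 2 (y t); have m4 := moment_ge0 4 (y t).
have e0 := expR_ge0 (- y t).
apply: (le_trans (ler_normD _ _)).
have h1 : `|d * (expR (- y t) - moment 2 (y t))| <= expR (- y t) + moment 2 (y t).
  rewrite normrM -[leRHS]mul1r ler_pM//.
    by case/orP: d01 => /eqP ->; rewrite ?normr0 ?normr1.
  by rewrite ler_norml; apply/andP; split; lra.
have h2 : `|z t * (x0 - tau * t) / (2 * t) * moment 4 (y t)| <= 3 * moment 2 (y t).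
  rewrite !normrM (ger0_norm m4) [`|(2 * t)^-1|]ger0_norm ?invr_ge0 ?mulr_ge0 ?(ltW t0)//.
  have zz : `|z t| * `|x0 - tau * t| <= q t.
    have a1 : `|z t| ^+ 2 <= q t by rewrite real_normK ?num_real.
    have a2 : `|x0 - tau * t| ^+ 2 <= q t by rewrite real_normK ?num_real.
    by have := sqr_ge0 (`|z t| - `|x0 - tau * t|); lra.
  apply: (@le_trans _ _ (q t / (2 * t) * moment 4 (y t))).
    by rewrite ler_wpM2r// ler_wpM2r// invr_ge0 mulr_ge0// ltW.
  rewrite (_ : q t / (2 * t) = 2 * y t); last by rewrite /y; field; rewrite gt_eqF.
  by have := mul_moment4_le y0; lra.
by rewrite /m; lra.
Qed.

(** The two summands bound m (1 + t) / t for t >= r / (2 tau) and for smaller t respectively. The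
    factor 4 absorbs the 2 in the denominator of the majorant and the 2 in (1 + sqrt t)^2 <= 2 (1 +
    t). *)
Let C : R := 4 * c * (5 * (2 * tau / r + 1) + 80 / r ^+ 2 * (1 + r / (2 * tau))).

(** Of order t^(-1/2) at 0 and t^(-3/2) at infinity, and the exact derivative of C sqrt t / (1 +
    sqrt t). *)
Definition majorant (t : R) : R := C / (2 * Num.sqrt t * (1 + Num.sqrt t) ^+ 2).

Lemma kernel_majorant (t : R) : 0 < t -> `|Oseen_kernel t| <= majorant t.
Proof.
move=> t0; have s0 : 0 < Num.sqrt t by rewrite sqrtr_gt0.
have y0 := y_ge0 t0.
have m0 : 0 <= m t by rewrite addr_ge0 ?expR_ge0// mulr_ge0// moment_ge0.
apply: (le_trans (kernel_le_m t0)).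
have r0 := r_gt0; have c0 := c_gt0.
have key : m t * (1 + t) <= C / (4 * c) * t.
  have r2 : 0 < r ^+ 2 by rewrite exprn_gt0.
  rewrite (_ : C / (4 * c) * t = 5 * (2 * tau / r * t + t) +
    80 / r ^+ 2 * t * (1 + r / (2 * tau))); last first.
    by rewrite /C; field; rewrite !gt_eqF.
  have p1 : 0 <= 80 / r ^+ 2 * t by rewrite mulr_ge0 ?divr_ge0 ?(ltW r2) ?(ltW t0).
  have p2 : 0 <= 2 * tau / r * t by rewrite !mulr_ge0 ?(ltW tau_gt0) ?(ltW t0)// invr_ge0 ltW.
  have p3 : 0 <= r / (2 * tau) by rewrite divr_ge0 ?mulr_ge0 ?(ltW tau_gt0) ?(ltW r_gt0).
  (* Up to half the time r / tau that the drift needs to cover the distance r, q >= r^2 / 4 and y m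
     <= 5 gives m <= 80 t / r^2; afterwards m <= 5 is enough. *)
  have [tD|tD] := leP (r / (2 * tau)) t.
    have h1 : 1 <= 2 * tau / r * t.
      rewrite ler_pdivrMr ?mulr_gt0// in tD.
      by rewrite mulrAC ler_pdivlMr// mul1r; lra.
    have h2 := m_le5 t0.
    have h3 : m t * (1 + t) <= 5 * (1 + t) by rewrite ler_wpM2r//; lra.
    have h4 : 0 <= 80 / r ^+ 2 * t * (1 + r / (2 * tau)).
      by apply: mulr_ge0 => //; lra.
    apply: (le_trans h3); rewrite -[leLHS]addr0; apply: lerD => //.
    by rewrite ler_pM2l//; lra.
  have h1 : m t <= 80 / r ^+ 2 * t.
    have qr : r ^+ 2 / 4 <= q t.
      apply: le_trans (q_ge (ltW t0)).
      rewrite ltr_pdivlMr ?mulr_gt0// in tD.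
      have : 0 <= (r - tau * t - r / 2) * (r - tau * t + r / 2) by apply: mulr_ge0; lra.
      by lra.
    have qm := ym_le5 t0.
    have {}qm : q t * m t <= 20 * t.
      rewrite /y mulrAC ler_pdivrMr in qm; last by rewrite mulr_gt0.
      by lra.
    have : r ^+ 2 / 4 * m t <= 20 * t by apply: le_trans qm; rewrite ler_wpM2r.
    by move=> hm; rewrite (mulrAC 80) ler_pdivlMr//; lra.
  have h3 : m t * (1 + t) <= 80 / r ^+ 2 * t * (1 + r / (2 * tau)).
    by apply: ler_pM => //; lra.
  by lra.
have s2 : Num.sqrt t ^+ 2 = t by rewrite sqr_sqrtr// ltW.
rewrite /majorant ler_pdivlMr; last by rewrite !mulr_gt0// exprn_gt0//; lra.
rewrite (_ : _ * m t * _ = 2 * c / t * (m t * (1 + Num.sqrt t) ^+ 2)); last first.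
  move: s2 s0; generalize (Num.sqrt t) (m t) => s n <- s0.
  by field; rewrite gt_eqF.
have ss : (1 + Num.sqrt t) ^+ 2 <= 2 * (1 + t).
  by rewrite -{2}s2 -subr_ge0 (_ : _ - _ = (1 - Num.sqrt t) ^+ 2) ?sqr_ge0//; ring.
apply: (@le_trans _ _ (2 * c / t * (2 * (m t * (1 + t))))).
  apply: ler_wpM2l; first by rewrite divr_ge0 ?mulr_ge0 ?(ltW c_gt0) ?(ltW t0).
  by rewrite (_ : 2 * (m t * _) = m t * (2 * (1 + t))) ?ler_wpM2l//; ring.
apply: (@le_trans _ _ (2 * c / t * (2 * (C / (4 * c) * t)))).
  apply: ler_wpM2l; first by rewrite divr_ge0 ?mulr_ge0 ?(ltW c_gt0) ?(ltW t0).
  exact: ler_wpM2l.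
by rewrite le_eqVlt; apply/orP; left; apply/eqP; field; rewrite !gt_eqF.
Qed.

(* With s = sqrt t one has (a / s +- b s)^2 = y + tau x0 / 2 +- 2 a b, so both error
   functions below have derivatives proportional to exp(- y). *)
Let a : R := r / 2.
Let b : R := tau / 2.
Let W : R := expR (2 * a * b).
Let kap : R := expR (tau * x0 / 2).
Let sg (t : R) : R := Num.sqrt t.
Let Ap (t : R) := erf0 (a / sg t + b * sg t).
Let Am (t : R) := erf0 (a / sg t - b * sg t).
(** The weights kap W and kap / W turn the derivatives of the error functions into exp(-y) times (b
    t^(-1/2) - a t^(-3/2)) / 2 and (- b t^(-1/2) - a t^(-3/2)) / 2; sum and difference isolate one
    power each. *)
Let Sp (t : R) := kap * (W * Ap t + W^-1 * Am t).
Let Sm (t : R) := kap * (W * Ap t - W^-1 * Am t).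

Let a_gt0 : 0 < a. Proof. by rewrite divr_gt0. Qed.
Let b_gt0 : 0 < b. Proof. by rewrite divr_gt0. Qed.
Let W_gt0 : 0 < W. Proof. exact: expR_gt0. Qed.
Let sg_gt0 (t : R) : 0 < t -> 0 < sg t. Proof. by rewrite sqrtr_gt0. Qed.
Let sg_sqr (t : R) : 0 < t -> sg t ^+ 2 = t. Proof. by move=> t0; rewrite sqr_sqrtr// ltW. Qed.

Let dsg (t : R) : 0 < t -> is_derive t 1 sg (2 * sg t)^-1.
Proof. exact: is_derive1_sqrt. Qed.

Let dy (t : R) : 0 < t -> is_derive t 1 y (- (tau * (x0 - tau * t) / (2 * t)) - y t / t).
Proof.
move=> t0; rewrite /y /q; derive_by; first by rewrite mulf_neq0// gt_eqF.
by rewrite /= /q; field; rewrite gt_eqF.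
Qed.

Let yE (t : R) : 0 < t -> y t = a ^+ 2 / t + b ^+ 2 * t - tau * x0 / 2.
Proof. by move=> t0; rewrite /y /q /a /b; field; rewrite gt_eqF. Qed.

Let dAp (t : R) : 0 < t -> is_derive t 1 Ap
  (expR (- y t) / (kap * W) * (b / (2 * sg t) - a / (2 * sg t ^+ 3))).
Proof.
move=> t0; have s0 := sg_gt0 t0; have hs := dsg t0.
have hu : is_derive t 1 (fun t => a / sg t + b * sg t) (b / (2 * sg t) - a / (2 * sg t ^+ 3)).
  derive_by; first by rewrite gt_eqF.
  by rewrite /=; field; rewrite gt_eqF.
apply: (is_derive_val (is_derive1_fun_erf0 hu)); congr (_ * _).
rewrite /kap /W -expRD -expRN -expRD; congr expR; rewrite (yE t0).
by rewrite -{3 4}(sg_sqr t0); field; rewrite gt_eqF.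
Qed.

Let dAm (t : R) : 0 < t -> is_derive t 1 Am
  (expR (- y t) / kap * W * (- b / (2 * sg t) - a / (2 * sg t ^+ 3))).
Proof.
move=> t0; have s0 := sg_gt0 t0; have hs := dsg t0.
have hu : is_derive t 1 (fun t => a / sg t - b * sg t) (- b / (2 * sg t) - a / (2 * sg t ^+ 3)).
  derive_by; first by rewrite gt_eqF.
  by rewrite /=; field; rewrite gt_eqF.
apply: (is_derive_val (is_derive1_fun_erf0 hu)); congr (_ * _).
rewrite /kap /W -expRN -!expRD; congr expR; rewrite (yE t0).
by rewrite -{3 4}(sg_sqr t0); field; rewrite gt_eqF.
Qed.

Let dSp (t : R) : 0 < t -> is_derive t 1 Sp (- a * expR (- y t) / sg t ^+ 3).
Proof.
move=> t0; have s0 := sg_gt0 t0; have hp := dAp t0; have hm := dAm t0.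
have k0 : kap != 0 by rewrite gt_eqF// expR_gt0.
by rewrite /Sp; derive_by; rewrite /=; field; rewrite !gt_eqF ?expR_gt0.
Qed.

Let dSm (t : R) : 0 < t -> is_derive t 1 Sm (b * expR (- y t) / sg t).
Proof.
move=> t0; have s0 := sg_gt0 t0; have hp := dAp t0; have hm := dAm t0.
have k0 : kap != 0 by rewrite gt_eqF// expR_gt0.
by rewrite /Sm; derive_by; rewrite /=; field; rewrite !gt_eqF ?expR_gt0.
Qed.

(* Integrates K d/2 + K x_j / (2 tau t) - G' / tau, where K is the heat kernel and G the
   j-th derivative of the convolution, both along x - tau t e_1. *)
Definition primitive (t : R) : R :=
  - (d * c / (2 * a)) * Sp t
  + xj * c / (2 * tau * a ^+ 2) * (expR (- y t) / sg t + b * Sm t - (2 * a)^-1 * Sp t)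
  + c / tau * (z t * (moment 2 (y t) / sg t ^+ 3)).

(** In the second summand, differentiating exp(-y) / sqrt t gives a^2 exp(-y) t^(-5/2) plus terms in
    t^(-1/2) and t^(-3/2), which the multiples of Sm and Sp cancel. *)
Lemma is_derive_primitive (t : R) : 0 < t -> is_derive t 1 primitive (Oseen_kernel t).
Proof.
move=> t0; have s0 := sg_gt0 t0; have hp := dSp t0; have hm := dSm t0.
have hs := dsg t0; have hy := dy t0; have hM := is_derive1_fun_moment 2 hy.
have hz : is_derive t 1 z (- tau * d) by rewrite /z; derive_by; rewrite /=; ring.
rewrite /primitive; derive_by; rewrite ?expf_eq0 ?gt_eqF//=.
rewrite /Oseen_kernel -/(sg t).
(* Eliminating the exponential leaves M_2 and M_4 as free variables, so the claim becomes a rational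
   identity. *)
have eE : expR (- y t) = 3 * moment 2 (y t) - 2 * y t * moment 4 (y t).
  by rewrite moment_rec; ring.
rewrite eE; have := yE t0; generalize (moment 2 (y t)) (moment 4 (y t)) (Sp t) (Sm t) (y t).
move=> M2 M4 S1 S2 yt ->; rewrite /z /b -(sg_sqr t0) -/(sg _).
have -> : sg (sg t ^+ 2) = sg t by rewrite sg_sqr.
by field; rewrite !gt_eqF.
Qed.

Lemma is_derive_majorant_primitive (t : R) : 0 < t ->
  is_derive t 1 (fun t => C * (sg t / (1 + sg t))) (majorant t).
Proof.
move=> t0; have s0 := sg_gt0 t0; have hs := dsg t0.
derive_by; first by rewrite gt_eqF//; lra.
rewrite /= /majorant -/(sg t); field; rewrite !gt_eqF//; lra.
Qed.

Lemma continuous_Oseen_kernel (t : R) : 0 < t -> {for t, continuous Oseen_kernel}.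
Proof.
move=> t0; have s0 := sg_gt0 t0; have hs := dsg t0; have hy := dy t0.
have h2 := is_derive1_fun_moment 2 hy; have h4 := is_derive1_fun_moment 4 hy.
have [e h] : exists e, is_derive t 1 Oseen_kernel e.
  eexists; rewrite /Oseen_kernel /z.
  have -> : @Num.sqrt R = sg by [].
  by derive_rules; rewrite ?expf_eq0 ?mulf_neq0 ?gt_eqF.
exact: is_derive_continuous h.
Qed.

Lemma continuous_majorant (t : R) : 0 < t -> {for t, continuous majorant}.
Proof.
move=> t0; have s0 := sg_gt0 t0; have hs := dsg t0.
have [e h] : exists e, is_derive t 1 majorant e.
  eexists; rewrite /majorant.
  have -> : @Num.sqrt R = sg by [].
  derive_rules; rewrite mulf_neq0 ?expf_eq0 ?mulf_neq0 ?gt_eqF//; lra.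
exact: is_derive_continuous h.
Qed.

(** * Limits at both ends of the half-line *)

Let sg_0 : sg t @[t --> 0^'+] --> (0 : R).
Proof.
by apply: cvg_at_right_filter; rewrite -[X in _ --> X]sqrtr0; exact: sqrt_continuous.
Qed.

Let sgV_0 : (sg t)^-1 @[t --> 0^'+] --> +oo.
Proof.
apply/cvgrVy; last exact: sg_0.
by near=> t; apply: sg_gt0; near: t; exact: nbhs_right_gt.
Unshelve. all: end_near. Qed.

Let sg_y : sg t @[t --> +oo] --> +oo.
Proof. exact: sqrt_cvgy. Qed.

Let sgV_y : (sg t)^-1 @[t --> +oo] --> (0 : R).
Proof.
apply/gtr0_cvgV0; last exact: sg_y.
by near=> t; apply: sg_gt0; near: t; exact: nbhs_pinfty_gt.
Unshelve. all: end_near. Qed.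

Let Am_0 : Am t @[t --> 0^'+] --> (Num.sqrt pi / 2 : R).
Proof.
apply: erf0_comp_cvgy.
apply/cvgryPge => A; near=> t.
have s0 : 0 < sg t by apply: sg_gt0; near: t; exact: nbhs_right_gt.
have s1 : sg t <= 1 by near: t; exact: (cvgr_le _ sg_0).
have sV : (A + b) / a <= (sg t)^-1 by near: t; exact: ((cvgryPge _).1 sgV_0).
rewrite ler_pdivrMr// in sV; have := b_gt0.
have : b * sg t <= b * 1 by rewrite ler_pM2l.
by rewrite (mulrC a); lra.
Unshelve. all: end_near. Qed.

Let Ap_0 : Ap t @[t --> 0^'+] --> (Num.sqrt pi / 2 : R).
Proof.
apply: erf0_comp_cvgy.
apply/cvgryPge => A; near=> t.
have s0 : 0 < sg t by apply: sg_gt0; near: t; exact: nbhs_right_gt.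
have sV : A / a <= (sg t)^-1 by near: t; exact: ((cvgryPge _).1 sgV_0).
rewrite ler_pdivrMr// in sV.
by have := mulr_gt0 b_gt0 s0; rewrite (mulrC a); lra.
Unshelve. all: end_near. Qed.

Let Ap_y : Ap t @[t --> +oo] --> (Num.sqrt pi / 2 : R).
Proof.
apply: erf0_comp_cvgy.
apply/cvgryPge => A; near=> t.
have s0 : 0 < sg t by apply: sg_gt0; near: t; exact: nbhs_pinfty_gt.
have sV : A / b <= sg t by near: t; exact: ((cvgryPge _).1 sg_y).
rewrite ler_pdivrMr// in sV.
by have := divr_gt0 a_gt0 s0; rewrite (mulrC b); lra.
Unshelve. all: end_near. Qed.

(** Here the argument a / sqrt t - b sqrt t has changed sign, whereas that of Ap tends to +oo at
    both ends. *)
Let Am_y : Am t @[t --> +oo] --> (- (Num.sqrt pi / 2) : R).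
Proof.
apply: erf0_comp_cvgNy.
apply/cvgrNyPle => A; near=> t.
have s1 : 1 <= sg t by near: t; exact: ((cvgryPge _).1 sg_y).
have sV : (a - A) / b <= sg t by near: t; exact: ((cvgryPge _).1 sg_y).
rewrite ler_pdivrMr// in sV.
have : a / sg t <= a by rewrite ler_pdivrMr ?ler_peMr// ?(ltW a_gt0)//; lra.
by rewrite (mulrC b); lra.
Unshelve. all: end_near. Qed.

Let Sp_0 : Sp t @[t --> 0^'+] --> kap * (W * (Num.sqrt pi / 2) + W^-1 * (Num.sqrt pi / 2)).
Proof.
apply: cvgM; first exact: cvg_cst.
apply: cvgD; (apply: cvgM; first exact: cvg_cst).
  exact: Ap_0.
exact: Am_0.
Qed.

Let Sm_0 : Sm t @[t --> 0^'+] --> kap * (W * (Num.sqrt pi / 2) - W^-1 * (Num.sqrt pi / 2)).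
Proof.
apply: cvgM; first exact: cvg_cst.
apply: cvgB; (apply: cvgM; first exact: cvg_cst).
  exact: Ap_0.
exact: Am_0.
Qed.

Let Sp_y : Sp t @[t --> +oo] --> kap * (W * (Num.sqrt pi / 2) + W^-1 * - (Num.sqrt pi / 2)).
Proof.
apply: cvgM; first exact: cvg_cst.
apply: cvgD; (apply: cvgM; first exact: cvg_cst).
  exact: Ap_y.
exact: Am_y.
Qed.

Let Sm_y : Sm t @[t --> +oo] --> kap * (W * (Num.sqrt pi / 2) - W^-1 * - (Num.sqrt pi / 2)).
Proof.
apply: cvgM; first exact: cvg_cst.
apply: cvgB; (apply: cvgM; first exact: cvg_cst).
  exact: Ap_y.
exact: Am_y.
Qed.

Let q_cont : continuous q.
Proof.
move=> t; have [e h] : exists e, is_derive t 1 q e by eexists; rewrite /q; derive_rules.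
exact: is_derive_continuous h.
Qed.

Let q_0 : q t @[t --> 0^'+] --> r ^+ 2.
Proof.
apply: cvg_at_right_filter; have := @q_cont 0.
by rewrite /continuous_at {2}/q !mulr0 mul0r expr0n/= subr0 addr0.
Qed.

Let near0_q : \forall t \near (0 : R)^'+, r ^+ 2 / 4 <= q t.
Proof.
apply: (cvgr_ge _ q_0); have : 0 < r ^+ 2 by rewrite exprn_gt0.
by lra.
Qed.

(** From y exp(-y) <= 1 and q >= r^2 / 4 near 0, exp(-y) <= 16 t / r^2. *)
Let e_0 : expR (- y t) / sg t @[t --> 0^'+] --> (0 : R).
Proof.
apply: (@squeeze_cvgr _ _ _ _ (cst 0) (fun t => 16 / r ^+ 2 * sg t)).
- near=> t; have t0 : 0 < t by near: t; exact: nbhs_right_gt.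
  have s0 := sg_gt0 t0.
  have qr : r ^+ 2 / 4 <= q t by near: t; exact: near0_q.
  have r2 : 0 < r ^+ 2 by rewrite exprn_gt0.
  rewrite divr_ge0 ?expR_ge0 ?(ltW s0)//=.
  rewrite ler_pdivrMr// (_ : _ * sg t * sg t = 16 * sg t ^+ 2 / r ^+ 2); last by ring.
  rewrite (sg_sqr t0) ler_pdivlMr//.
  have h := mul_expRN_le1 (y_ge0 t0).
  have {}h : q t * expR (- y t) <= 4 * t.
    by rewrite /y mulrAC ler_pdivrMr ?mulr_gt0// in h; lra.
  have : r ^+ 2 / 4 * expR (- y t) <= q t * expR (- y t) by rewrite ler_wpM2r ?expR_ge0.
  by lra.
- exact: cvg_cst.
- by rewrite -[X in _ --> X](mulr0 (16 / r ^+ 2)); apply: cvgM => //; exact: cvg_cst.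
Unshelve. all: end_near. Qed.

Let e_y : expR (- y t) / sg t @[t --> +oo] --> (0 : R).
Proof.
apply: (@squeeze_cvgr _ _ _ _ (cst 0) (fun t => (sg t)^-1)) => //.
  near=> t; have t0 : 0 < t by near: t; exact: nbhs_pinfty_gt.
  have s0 := sg_gt0 t0; rewrite divr_ge0 ?expR_ge0 ?(ltW s0)//=.
  by rewrite ler_pdivrMr// mulVf ?gt_eqF// expRN_le1// y_ge0.
exact: cvg_cst.
Unshelve. all: end_near. Qed.

Let y_0 : y t @[t --> 0^'+] --> +oo.
Proof.
apply/cvgryPge => A; near=> t.
have t0 : 0 < t by near: t; exact: nbhs_right_gt.
have qr : r ^+ 2 / 4 <= q t by near: t; exact: near0_q.
have r2 : 0 < r ^+ 2 by rewrite exprn_gt0.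
have A1 : 0 < `|A| + 1 by rewrite ltr_wpDl.
have tA : t <= r ^+ 2 / (16 * (`|A| + 1)).
  by near: t; apply: nbhs_right_le; rewrite divr_gt0// mulr_gt0.
rewrite ler_pdivlMr ?mulr_gt0// in tA.
rewrite /y ler_pdivlMr ?mulr_gt0//.
have : A * (4 * t) <= (`|A| + 1) * (4 * t).
  by rewrite ler_wpM2r ?mulr_ge0 ?(ltW t0)//; have := ler_norm A; lra.
by lra.
Unshelve. all: end_near. Qed.

(** The quotient is of type 0/0. The recursion and sqrt(y) M_0(y) = erf0(sqrt y) rewrite it with the
    error function at sqrt y, which tends to infinity. The value reflects that the gradient of N *
    K_t tends to that of N. *)
Let M_0 : moment 2 (y t) / sg t ^+ 3 @[t --> 0^'+] --> 2 * Num.sqrt pi / r ^+ 3.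
Proof.
have l : 2 / q t * (2 * erf0 (Num.sqrt (y t)) / Num.sqrt (q t) - expR (- y t) / sg t)
    @[t --> 0^'+] --> 2 / r ^+ 2 * (2 * (Num.sqrt pi / 2) / Num.sqrt (r ^+ 2) - 0).
  have r2 : r ^+ 2 != 0 by rewrite expf_eq0/= gt_eqF.
  apply: cvgM; first by apply: cvgM; [exact: cvg_cst|exact: cvgV].
  apply: cvgB => //; apply: cvgM.
    apply: cvgM; first exact: cvg_cst.
    apply: erf0_comp_cvgy.
    exact: (cvg_comp _ _ y_0 sqrt_cvgy).
  apply: cvgV; first by rewrite sqrtr_sqr normr_eq0 gt_eqF.
  by apply: continuous_cvg => //; exact: sqrt_continuous.
have -> : 2 * Num.sqrt pi / r ^+ 3 =
    2 / r ^+ 2 * (2 * (Num.sqrt pi / 2) / Num.sqrt (r ^+ 2) - 0).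
  by rewrite sqrtr_sqr ger0_norm ?(ltW r_gt0)//; field; rewrite gt_eqF.
apply: cvg_trans l; apply: near_eq_cvg.
near=> t; have t0 : 0 < t by near: t; exact: nbhs_right_gt.
have qr : r ^+ 2 / 4 <= q t by near: t; exact: near0_q.
have r2 : 0 < r ^+ 2 by rewrite exprn_gt0.
have q0 : 0 < q t by lra.
have s0 := sg_gt0 t0.
have m2 := moment_rec 0 (y t); rewrite mul1r in m2.
have p0 : 0 < Num.sqrt (q t) by rewrite sqrtr_gt0.
have sy : Num.sqrt (y t) = Num.sqrt (q t) / (2 * sg t).
  rewrite /y sqrtrM// sqrtrV ?mulr_ge0 ?(ltW t0)// sqrtrM//.
  by rewrite (_ : 4 = 2 ^+ 2 :> R) ?sqrtr_sqr ?ger0_norm// expr2 -natrM.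
rewrite /erf0 sqr_sqrtr ?y_ge0// sy.
have -> : expR (- y t) = moment 0 (y t) - 2 * y t * moment 2 (y t) by rewrite m2; ring.
have yq : y t = q t / (4 * sg t ^+ 2) by rewrite (sg_sqr t0).
move: s0 q0 p0 yq; generalize (moment 0 (y t)) (moment 2 (y t)) (sg t) (Num.sqrt (q t)) (q t).
by move=> M0 M2 s sq qt s0 q0 p0 ->; field; rewrite !gt_eqF.
Unshelve. all: end_near. Qed.

(** For j = 1 the factor z grows linearly. Once q >= 1, |z| <= q, and q M_2 <= 4 t from y M_2 <= 1
    leaves the bound 4 / sqrt t. *)
Let zM_y : z t * (moment 2 (y t) / sg t ^+ 3) @[t --> +oo] --> (0 : R).
Proof.
have l : 4 * (sg t)^-1 @[t --> +oo] --> (0 : R).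
  by rewrite -[X in _ --> X](mulr0 4); apply: cvgM => //; exact: cvg_cst.
apply: (@squeeze_cvgr _ _ _ _ (fun t => - (4 * (sg t)^-1)) (fun t => 4 * (sg t)^-1)) => //.
  near=> t; have t0 : 0 < t by near: t; exact: nbhs_pinfty_gt.
  have s0 := sg_gt0 t0.
  rewrite -ler_norml normrM [`|_ / _|]ger0_norm ?divr_ge0 ?moment_ge0 ?exprn_ge0 ?(ltW s0)//.
  have tr : (r + 1) / tau <= t by near: t; apply: nbhs_pinfty_ge; exact: num_real.
  rewrite ler_pdivrMr// in tr.
  have q1 : 1 <= q t.
    apply: le_trans (q_ge (ltW t0)).
    have : 0 <= (tau * t - r - 1) * (tau * t - r + 1) by apply: mulr_ge0; lra.
    by lra.
  have zq : `|z t| <= q t.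
    rewrite -(@ler_pXn2r _ 2)// ?nnegrE// real_normK ?num_real//.
    by apply: (le_trans (z_le t)); rewrite expr2 ler_peMr.
  have h := mul_moment2_le1 (y_ge0 t0).
  rewrite /y mulrAC ler_pdivrMr ?mulr_gt0// mul1r in h.
  have : `|z t| * moment 2 (y t) <= 4 * t.
    by apply: le_trans h; rewrite ler_wpM2r// moment_ge0.
  by rewrite mulrA ler_pdivrMr ?exprn_gt0// exprS mulrA mulfVK ?gt_eqF// (sg_sqr t0).
by rewrite -[X in _ --> X]oppr0; exact: cvgN.
Unshelve. all: end_near. Qed.

Let z_0 : z t @[t --> 0^'+] --> xj.
Proof.
apply: cvg_at_right_filter.
have [e h] : exists e, is_derive (0 : R) 1 z e by eexists; rewrite /z; derive_rules.
have z00 : z 0 = xj by rewrite /z mulr0 mul0r subr0.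
by rewrite -[X in _ --> X]z00; exact: is_derive_continuous h.
Qed.

Lemma integral_Oseen_kernel :
  (\int[mu]_(t in `]0%R, +oo[) (Oseen_kernel t)%:E = (E tau j 0 x)%:E)%E.
Proof.
pose A0 := - (d * c / (2 * a)) * (kap * (W * (Num.sqrt pi / 2) + W^-1 * (Num.sqrt pi / 2)))
    + xj * c / (2 * tau * a ^+ 2) * (0 + b * (kap * (W * (Num.sqrt pi / 2) - W^-1 * (Num.sqrt pi / 2)))
      - (2 * a)^-1 * (kap * (W * (Num.sqrt pi / 2) + W^-1 * (Num.sqrt pi / 2))))
    + c / tau * (xj * (2 * Num.sqrt pi / r ^+ 3)).
pose B0 := - (d * c / (2 * a)) * (kap * (W * (Num.sqrt pi / 2) + W^-1 * - (Num.sqrt pi / 2)))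
    + xj * c / (2 * tau * a ^+ 2) * (0 + b * (kap * (W * (Num.sqrt pi / 2) - W^-1 * - (Num.sqrt pi / 2)))
      - (2 * a)^-1 * (kap * (W * (Num.sqrt pi / 2) + W^-1 * - (Num.sqrt pi / 2))))
    + c / tau * 0.
(* Since Ap has equal limits at both ends, W drops out of the difference. The Am terms carry kap / W
   = exp(-[wake tau x]), and the limit of the gradient term at 0 supplies the part of E without
   exponential. *)
transitivity (B0 - A0)%:E; last first.
  congr EFin; rewrite E_col0//.
  have we : expR (- wake tau x) = kap / W.
    by rewrite /wake /kap /W -expRN -expRD; congr expR; rewrite /a /b -/r -/x0; field.
  rewrite we -/d -/r -/xj /A0 /B0 /a /b /c; have := W_gt0; have := r_gt0; have := tau_gt0.
  move: pi0 sqrtpi0; generalize (Num.sqrt (@pi R)) (@pi R) W kap xj d r.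
  move=> sp p w k xx dd rr p0 sp0 t0 r0 w0.
  by field; rewrite !gt_eqF.
apply: (dominated_FTC0y (f := Oseen_kernel) (g := majorant) (F := primitive) (A := A0) (B := B0)
  (G := fun t => C * (sg t / (1 + sg t))) (C := C * (0 / (1 + 0))) (D := C * 1)).
- exact: kernel_majorant.
- exact: is_derive_primitive.
- exact: is_derive_majorant_primitive.
- exact: continuous_Oseen_kernel.
- exact: continuous_majorant.
- apply: cvgD; last by apply: cvgM; [exact: cvg_cst|exact: cvgM].
  apply: cvgD; first by apply: cvgM; [exact: cvg_cst|].
  apply: cvgM; first exact: cvg_cst.
  apply: cvgB; last by apply: cvgM; [exact: cvg_cst|].
  by apply: cvgD => //; apply: cvgM; [exact: cvg_cst|].
- apply: cvgD; last by apply: cvgM; [exact: cvg_cst|].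
  apply: cvgD; first by apply: cvgM; [exact: cvg_cst|].
  apply: cvgM; first exact: cvg_cst.
  apply: cvgB; last by apply: cvgM; [exact: cvg_cst|].
  by apply: cvgD => //; apply: cvgM; [exact: cvg_cst|].
- apply: cvgM; first exact: cvg_cst.
  apply: cvgM => //; apply: cvgV; first by rewrite addr0 oner_eq0.
  by apply: cvgD => //; exact: cvg_cst.
- apply: cvgM; first exact: cvg_cst.
  have l : (1 + sg t)^-1 @[t --> +oo] --> (0 : R).
    apply/gtr0_cvgV0.
      near=> t; have t0 : 0 < t by near: t; exact: nbhs_pinfty_gt.
      by have := sg_gt0 t0; lra.
    apply/cvgryPge => A; near=> t.
    have : A <= sg t by near: t; exact: ((cvgryPge _).1 sg_y).
    by lra.
  have : 1 - (1 + sg t)^-1 @[t --> +oo] --> (1 : R).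
    by rewrite -[X in _ --> X]subr0; apply: cvgB => //; exact: cvg_cst.
  apply: cvg_trans; apply: near_eq_cvg; near=> t.
  have t0 : 0 < t by near: t; exact: nbhs_pinfty_gt.
  have s0 := sg_gt0 t0.
  have s1 : 1 + sg t != 0 by rewrite gt_eqF//; lra.
  by field.
Unshelve. all: end_near. Qed.

End TimeIntegral.

Theorem corollary4p5 (R : realType) (tau rho : R)
  (tau_gt0 : 0 < tau) (rho_neq0 : rho != 0)
  (j : 'I_3) (x : 'cV[R]_3) (x_neq0 : x != 0) :
  Z tau rho j 0 x 0 = (E tau j 0 x)%:E.
Proof.
rewrite -(integral_Oseen_kernel j tau_gt0 x_neq0); apply: eq_integral => t.
by rewrite inE/= in_itv/= andbT => t0; rewrite GammaE.
Qed.
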